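(* Let $a>1$ and let $\Psi=\{\psi_1,\psi_2,\dots,\psi_L\}$ be a finite subset of $L^2(\mathbb{R}_+)$ with cardinality $L$. Then $\mathcal{MD}(\Psi,a)$ is complete in $L^2(\mathbb{R}_+)$ if and only if $$\sum_{l=1}^{L}\left|\Theta_a\psi_l(x,\xi)\right|^2\neq 0\quad\text{for a.e. }(x,\xi)\in[1,a)\times[0,1).$$
   Context: $\mathbb{R}_+=(0,\infty)$, and $L^2(\mathbb{R}_+)$ is the space of complex-valued square-integrable functions on $\mathbb{R}_+$. A measurable function $h$ on $\mathbb{R}_+$ is $a$-dilation periodic if $h(ax)=h(x)$ for a.e. $x\in\mathbb{R}_+$. For $m\in\mathbb{Z}$, $\Lambda_m$ is the $a$-dilation periodic function on $\mathbb{R}_+$ determined by $\Lambda_m(x)=\frac{1}{\sqrt{a-1}}e^{\frac{2\pi i m x}{a-1}}$ for $x\in[1,a)$. For $c>0$, $D_c f(x)=\sqrt{c}\,f(cx)$. The dilation-and-modulation system is $\mathcal{MD}(\Psi,a)=\{\Lambda_m D_{a^j}\psi_l:\ m,j\in\mathbb{Z},\ 1\le l\le L\}$. The $\Theta_a$-transform of $f\in L^2(\mathbb{R}_+)$ is $\Theta_a f(x,\xi)=\sum_{l\in\mathbb{Z}}a^{l/2}f(a^l x)e^{-2\pi i l\xi}$ for a.e. $(x,\xi)\in\mathbb{R}_+\times\mathbb{R}$ (for a.e. $x$ the coefficient sequence is in $\ell^2(\mathbb{Z})$, so the series is a Fourier series converging in $L^2([0,1))$ in $\xi$). A system is complete in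 $L^2(\mathbb{R}_+)$ if the only $f\in L^2(\mathbb{R}_+)$ orthogonal to all its elements is $f=0$. *)

(* Defs.v *)
From HB Require Import structures.
From mathcomp Require Import all_boot all_order all_algebra.
From mathcomp Require Import all_classical all_reals all_analysis.
From mathcomp Require Import complex.

Set Implicit Arguments.
Unset Strict Implicit.
Unset Printing Implicit Defensive.
Import Order.TTheory GRing.Theory Num.Theory.
Import numFieldNormedType.Exports.
Local Open Scope classical_set_scope.
Local Open Scope ring_scope.
Local Open Scope complex_scope.

(* The half-line R_+ is the open interval ]0, +oo[. A function on R_+ is      *)
(* represented by a total function R -> R[i]; every definition below only     *)
(* looks at its values at positive reals. Elements of L^2 are represented by  *)
(* Borel functions, identified when they are equal almost everywhere.         *)

Definition Rplus (R : realType) : set (measurableTypeR R) := `]0, +oo[.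
Arguments Rplus : clear implicits.

Definition expi (R : realType) (t : R) : R[i] := cos t +i* sin t.

Definition cmeasurable d (T : measurableType d) (R : realType) (D : set T)
    (f : T -> R[i]) : Prop :=
  measurable_fun D (fun x => complex.Re (f x) : measurableTypeR R) /\
  measurable_fun D (fun x => complex.Im (f x) : measurableTypeR R).

Definition sqnorm_integral (R : realType) (D : set (measurableTypeR R))
    (f : R -> R[i]) : \bar R :=
  \int[lebesgue_measure]_(x in D) ((ComplexField.Normc.normc (f x)) ^+ 2)%:E.

Definition L2 (R : realType) (f : R -> R[i]) : Prop :=
  cmeasurable (Rplus R) (f : measurableTypeR R -> R[i]) /\
  (sqnorm_integral (Rplus R) f < +oo)%E.

Definition eqL2 (R : realType) (f g : R -> R[i]) : Prop :=
  {ae (@lebesgue_measure R), forall x, Rplus R x -> f x = g x}.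

Definition cintegral (R : realType) (D : set (measurableTypeR R))
    (f : R -> R[i]) : R[i] :=
  (\int[lebesgue_measure]_(x in D) complex.Re (f x)) +i*
  (\int[lebesgue_measure]_(x in D) complex.Im (f x)).

Definition inner (R : realType) (f g : R -> R[i]) : R[i] :=
  cintegral (Rplus R) (fun x => f x * conjc (g x)).

Definition complete_system (R : realType) (S : set (R -> R[i])) : Prop :=
  forall f : R -> R[i], L2 f -> (forall g, S g -> inner f g = 0) ->
    eqL2 f (fun=> 0).

(* For a > 1 and x > 0, dilation_index a x is the unique integer j such that  *)
(* a ^ j <= x < a ^ (j + 1), that is, such that x / a ^ j lies in [1, a).     *)
Definition dilation_index (R : realType) (a x : R) : int :=
  Num.floor (ln x / ln a).

(* The a-dilation periodic extension of its formula on [1, a); see LambdaE    *)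
(* and Lambda_periodic.                                                       *)
Definition Lambda (R : realType) (a : R) (m : int) (x : R) : R[i] :=
  ((Num.sqrt (a - 1))^-1)%:C *
  expi (2 * pi * m%:~R * (x / a ^ dilation_index a x) / (a - 1)).

Definition dilate (R : realType) (c : R) (f : R -> R[i]) (x : R) : R[i] :=
  (Num.sqrt c)%:C * f (c * x).

Definition MD (R : realType) (L : nat) (psi : 'I_L -> R -> R[i]) (a : R) :
    set (R -> R[i]) :=
  [set g | exists (m j : int) (l : 'I_L),
     g = (fun x => Lambda a m x * dilate (a ^ j) (psi l) x)].

Definition Theta_term (R : realType) (a : R) (f : R -> R[i]) (l : int)
    (x xi : R) : R[i] :=
  (a `^ (l%:~R / 2))%:C * f (a ^ l * x) * expi (- (2 * pi * l%:~R * xi)).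

(* The terms of index l = k - N for 0 <= k <= 2 N, that is -N <= l <= N.      *)
Definition Theta_partial_sum (R : realType) (a : R) (f : R -> R[i]) (N : nat)
    (x xi : R) : R[i] :=
  \sum_(k < (2 * N).+1) Theta_term a f (k%:Z - N%:Z) x xi.

(* F represents the class of Theta_a f: it is jointly measurable on R_+ x R,  *)
(* 1-periodic in xi, and for a.e. x > 0 the Fourier series converges to       *)
(* F (x, .) in L^2([0, 1)). These conditions determine F up to a null set of  *)
(* R_+ x R.                                                                   *)
Definition is_Theta (R : realType) (a : R) (f : R -> R[i])
    (F : measurableTypeR R * measurableTypeR R -> R[i]) : Prop :=
  [/\ cmeasurable (Rplus R `*` setT) F,
      forall x xi : R, 0 < x -> F (x, xi + 1) = F (x, xi) &
      {ae (@lebesgue_measure R), forall x, Rplus R x ->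
         (fun N => sqnorm_integral `[0, 1[
            (fun xi => Theta_partial_sum a f N x xi - F (x, xi)))
         @ \oo --> 0%E}].

(* A representative of Theta_a f, chosen once and for all; one exists for     *)
(* a > 1 and f in L^2(R_+), and the default value is irrelevant.              *)
Definition Theta (R : realType) (a : R) (f : R -> R[i]) :
    measurableTypeR R * measurableTypeR R -> R[i] :=
  xget (fun=> 0) (is_Theta a f).

Lemma LambdaE (R : realType) (a : R) (m : int) (x : R) :
  1 < a -> 1 <= x < a ->
  Lambda a m x =
    ((Num.sqrt (a - 1))^-1)%:C * expi (2 * pi * m%:~R * x / (a - 1)).
Proof.
move=> a1 /andP[x1 xa]; rewrite /Lambda /dilation_index.
have x0 : 0 < x by exact: lt_le_trans x1.
have a0 : 0 < a by exact: lt_trans a1.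
have -> : Num.floor (ln x / ln a) = 0.
  apply: Num.Theory.floor_def; rewrite add0r divr_ge0 ?ln_ge0 ?(ltW a1)//=.
  by rewrite ltr_pdivrMr ?ln_gt0// mul1r ltr_ln.
by rewrite expr0z divr1.
Qed.

Lemma Lambda_periodic (R : realType) (a : R) (m : int) (x : R) :
  1 < a -> 0 < x -> Lambda a m (a * x) = Lambda a m x.
Proof.
move=> a1 x0; rewrite /Lambda /dilation_index.
have a0 : 0 < a by exact: lt_trans a1.
have lna : 0 < ln a by rewrite ln_gt0.
have -> : Num.floor (ln (a * x) / ln a) = 1 + Num.floor (ln x / ln a).
  rewrite lnM ?posrE// mulrDl divff ?gt_eqF//.
  by rewrite Num.Theory.floorDzr ?Num.Theory.floor1.
rewrite expfzDr ?gt_eqF// expr1z.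
by rewrite -[a * x / _]mulf_div divff ?gt_eqF// mul1r.
Qed.

(* Main.v *)
Require Import Defs.
From mathcomp Require Import all_boot all_order all_algebra.
From mathcomp Require Import all_classical all_reals all_analysis.
From mathcomp Require Import complex ring lra zify measurable_realfun.
Import Order.TTheory GRing.Theory Num.Theory.
Import numFieldNormedType.Exports.
Local Open Scope classical_set_scope.
Local Open Scope ring_scope.
Local Open Scope complex_scope.
Set Implicit Arguments.
Unset Strict Implicit.
Unset Printing Implicit Defensive.

(** At a point [x > 0], the transform [Theta a f (x, _)] is the function on [[0, 1)]
    whose Fourier coefficients are the numbers [a ^ (l / 2) * f (a ^ l * x)]. The
    dilates [a ^ l * [1, a)] tile the half-line, and on each of them [Lambda a m] is
    the same exponential of period [a - 1]. Cutting the integral that defines the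
    inner product of [f] with the atom of indices [m], [j] along this tiling gives
      [\int_1^a conj (Lambda a m x) * G_j x dx],
    where [G_j x] is the correlation, at lag [j], of the coefficient sequences of [f]
    and [psi] at [x] ([inner_correlation_limit]). By Parseval's identity [G_j x] is
    also a Fourier coefficient, of order [- j], of the product
    [Theta a f (x, _) * conj (Theta a psi (x, _))]. Fourier coefficients determine an
    integrable function; applied on [[1, a)] and then on [[0, 1)], this shows that
    [f] is orthogonal to all the atoms of [psi] if and only if this product vanishes
    almost everywhere on [[1, a) * [0, 1)] ([orthogonal_atomsP]).

    If the transforms of the generators have no common zeros, up to a null set, then
    the transform of a function orthogonal to the system vanishes, and so does the
    function. Conversely, let [E] be the set of common zeros. The function [f] whose
    coefficients are those of the fibres of the indicator of [E] is square-integrable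
    by Bessel's inequality ([L2_inverse_transform]), its transform is this indicator,
    and it is orthogonal to the system. If the system is complete then [f] vanishes,
    and [E] is null.

    Three facts of analysis carry the argument. Uniqueness of Fourier coefficients of
    integrable functions ([trig_orthogonal_eq0]) is obtained from explicit
    trigonometric polynomials that converge boundedly to the indicator of an interval,
    and from Lebesgue's differentiation theorem. The transform exists as a jointly
    measurable function ([is_Theta_exists]): this is the Riesz-Fischer theorem in each
    fibre, with the truncation of the series chosen measurably in [x]. Finally,
    integrals over the half-line are integrals of periodizations over a period
    ([ge0_integral_periodize], [Rintegral_periodize]). *)

(** * Almost everywhere statements *)

Section AlmostEverywhere.
Context d (T : measurableType d) (R : realType) (mu : {measure set T -> \bar R}).

Lemma ae_mono (P Q : T -> Prop) : (forall x, P x -> Q x) ->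
  {ae mu, forall x, P x} -> {ae mu, forall x, Q x}.
Proof. by move=> PQ; apply: negligibleS => x /= nQ /PQ. Qed.

Lemma ae_and (P Q : T -> Prop) :
  {ae mu, forall x, P x} -> {ae mu, forall x, Q x} ->
  {ae mu, forall x, P x /\ Q x}.
Proof.
move=> hP hQ; apply: negligibleS (negligibleU hP hQ) => x /= /not_andP.
by case; [left|right].
Qed.

End AlmostEverywhere.


(** * Uniqueness of trigonometric moments *)

Section Uniqueness.
Context {R : realType}.
Local Notation lam := (@lebesgue_measure R).
Implicit Types (D : set (measurableTypeR R)) (u h : R -> R).

Lemma integrable_mul_bounded (D : set (measurableTypeR R)) (u h : R -> R) (M : R) :
  measurable D -> lam.-integrable D (EFin \o u) ->
  measurable_fun D (h : measurableTypeR R -> measurableTypeR R) ->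
  (forall x, D x -> `|h x| <= M) ->
  lam.-integrable D (EFin \o (fun x => u x * h x)).
Proof.
move=> mD iu mh hM.
have := integrableMl mD iu mh; apply.
exists M; split; first exact: num_real.
by move=> y My x Dx /=; apply: le_trans (ltW My); exact: hM.
Qed.

Lemma integrableZ_EFin D u (c : R) : measurable D ->
  lam.-integrable D (EFin \o u) -> lam.-integrable D (EFin \o (fun x => c * u x)).
Proof. by move=> mD iu; exact: (integrableZl mD c iu). Qed.

Lemma integrableD_EFin D u h : measurable D ->
  lam.-integrable D (EFin \o u) -> lam.-integrable D (EFin \o h) ->
  lam.-integrable D (EFin \o (fun x => u x + h x)).
Proof. by move=> mD iu ih; exact: (integrableD mD iu ih). Qed.

Lemma measurable_cos_affine D (c d : R) :
  measurable_fun D (fun x : measurableTypeR R => cos (c * x + d) : measurableTypeR R).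
Proof.
apply: (measurable_funS measurableT) => //.
apply: continuous_measurable_fun => x.
apply: continuous_comp; last exact: continuous_cos.
by apply: cvgD; [apply: cvgM; [exact: cvg_cst|exact: cvg_id]|exact: cvg_cst].
Qed.

Lemma measurable_sin_affine D (c d : R) :
  measurable_fun D (fun x : measurableTypeR R => sin (c * x + d) : measurableTypeR R).
Proof.
apply: (measurable_funS measurableT) => //.
apply: continuous_measurable_fun => x.
apply: continuous_comp; last exact: continuous_sin.
by apply: cvgD; [apply: cvgM; [exact: cvg_cst|exact: cvg_id]|exact: cvg_cst].
Qed.

Lemma normr_cos_le1 (x : R) : `|cos x| <= 1.
Proof. by rewrite ler_norml cos_geN1 cos_le1. Qed.

Lemma normr_sin_le1 (x : R) : `|sin x| <= 1.
Proof. by rewrite ler_norml sin_geN1 sin_le1. Qed.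

Lemma integrable_mul_cos D u (c d : R) :
  measurable D -> lam.-integrable D (EFin \o u) ->
  lam.-integrable D (EFin \o (fun x => u x * cos (c * x + d))).
Proof.
move=> mD iu; apply: (@integrable_mul_bounded D u _ 1) => //.
- exact: measurable_cos_affine.
- by move=> x _; exact: normr_cos_le1.
Qed.

Lemma integrable_mul_sin D u (c d : R) :
  measurable D -> lam.-integrable D (EFin \o u) ->
  lam.-integrable D (EFin \o (fun x => u x * sin (c * x + d))).
Proof.
move=> mD iu; apply: (@integrable_mul_bounded D u _ 1) => //.
- exact: measurable_sin_affine.
- by move=> x _; exact: normr_sin_le1.
Qed.

(** The phase [d] covers cosines and sines at once. *)
Definition trig_orthogonal (w : R) D u : Prop :=
  lam.-integrable D (EFin \o u) /\
  forall (m : int) (d : R), \int[lam]_(x in D) (u x * cos (w * m%:~R * x + d)) = 0.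

Lemma trig_orthogonalD w D u h : measurable D ->
  trig_orthogonal w D u -> trig_orthogonal w D h ->
  trig_orthogonal w D (fun x => u x + h x).
Proof.
move=> mD [iu zu] [ih zh]; split; first exact: integrableD_EFin.
move=> m d; under eq_Rintegral do rewrite mulrDl.
rewrite RintegralD //; first by rewrite zu zh addr0.
- exact: integrable_mul_cos.
- exact: integrable_mul_cos.
Qed.

Lemma trig_orthogonalZ w D u (c : R) : measurable D ->
  trig_orthogonal w D u -> trig_orthogonal w D (fun x => c * u x).
Proof.
move=> mD [iu zu]; split; first exact: integrableZ_EFin.
move=> m d; under eq_Rintegral do rewrite -mulrA.
rewrite RintegralZl //; first by rewrite zu mulr0.
exact: integrable_mul_cos.
Qed.

(** The product of two cosines is a sum of two cosines, whose frequencies are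
    again multiples of [w]: orthogonality survives multiplication by a
    trigonometric polynomial, and the product of a function with any sequence of
    polynomials in it stays in the class. *)
Lemma trig_orthogonal_mul_cos w D u (e : R) : measurable D ->
  trig_orthogonal w D u -> trig_orthogonal w D (fun x => u x * cos (w * x + e)).
Proof.
move=> mD [iu zu]; split; first exact: integrable_mul_cos.
move=> m d.
transitivity (\int[lam]_(x in D)
   (2^-1 * (u x * cos (w * (m + 1)%:~R * x + (d + e))) +
    2^-1 * (u x * cos (w * (m - 1)%:~R * x + (d - e))))).
  apply: eq_Rintegral => x _.
  set A := w * m%:~R * x + d; set B := w * x + e.
  have -> : w * (m + 1)%:~R * x + (d + e) = A + B by rewrite /A /B intrD; ring.
  have -> : w * (m - 1)%:~R * x + (d - e) = A - B
    by rewrite /A /B intrD; ring.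
  by rewrite (cosD A B) (cosB A B); field.
rewrite RintegralD //; last 2 first.
- by apply: integrableZ_EFin => //; exact: integrable_mul_cos.
- by apply: integrableZ_EFin => //; exact: integrable_mul_cos.
rewrite !RintegralZl //; last 2 first.
- exact: integrable_mul_cos.
- exact: integrable_mul_cos.
by rewrite !zu !mulr0 addr0.
Qed.

Lemma eq_trig_orthogonal w D u h : u =1 h ->
  trig_orthogonal w D u -> trig_orthogonal w D h.
Proof. by move=> /funext ->. Qed.

Lemma trig_orthogonal_mul_exp w D u (v : R -> R) : measurable D ->
  (forall u, trig_orthogonal w D u -> trig_orthogonal w D (fun x => u x * v x)) ->
  trig_orthogonal w D u -> forall n k,
  trig_orthogonal w D (fun x => u x * (1 - v x ^+ n) ^+ k).
Proof.
move=> mD hv zu n k; elim: k u zu => [|k IH] u zu.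
  by apply: eq_trig_orthogonal zu => x; rewrite expr0 mulr1.
have hn m u' : trig_orthogonal w D u' ->
    trig_orthogonal w D (fun x => u' x * v x ^+ m).
  elim: m u' => [|m IHm] u' zu'.
    by apply: eq_trig_orthogonal zu' => x; rewrite expr0 mulr1.
  have := IHm _ (hv _ zu').
  by apply: eq_trig_orthogonal => x; rewrite exprS mulrA.
have zu1 : trig_orthogonal w D (fun x => u x * (1 - v x ^+ n)).
  have := trig_orthogonalD mD zu (trig_orthogonalZ (-1) mD (hn n _ zu)).
  by apply: eq_trig_orthogonal => x; ring.
have := IH _ zu1.
by apply: eq_trig_orthogonal => x; rewrite exprS mulrA.
Qed.

(** Bernoulli's inequality bounds the expression below by [1 - (2 v) ^ n]. *)
Lemma cvg_exp_one_sub_exp_small (v : R) : 0 <= v < 2^-1 ->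
  (fun n => (1 - v ^+ n) ^+ (2 ^ n)) @ \oo --> (1 : R).
Proof.
move=> /andP[v0 v1].
have bern (w : R) k : 0 <= w <= 1 -> 1 - k%:R * w <= (1 - w) ^+ k.
  move=> /andP[w0 w1]; elim: k => [|k IH]; first by rewrite mul0r subr0 expr0.
  have hk : (0 : R) <= k%:R by [].
  rewrite exprS; have : (1 - w) * (1 - k%:R * w) <= (1 - w) * (1 - w) ^+ k.
    by apply: ler_wpM2l => //; rewrite subr_ge0.
  by apply: le_trans; rewrite -natr1; nra.
have c : (fun n => 1 - (2 * v) ^+ n) @ \oo --> (1 : R).
  rewrite -[X in _ --> X]subr0; apply: cvgB; first exact: cvg_cst.
  by apply: cvg_expr; rewrite ger0_norm; lra.
apply: squeeze_cvgr c (cvg_cst (1 : R)).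
near=> n; have vn : 0 <= v ^+ n <= 1.
  by rewrite exprn_ge0 //= exprn_ile1 //; lra.
apply/andP; split.
  by have := bern _ (2 ^ n)%N vn; rewrite exprMn natrX.
by case/andP: vn => vn0 vn1; apply: exprn_ile1; lra.
Unshelve. all: by end_near. Qed.

(** Since [(1 - w) (1 + w) <= 1], Bernoulli's inequality for [1 + v ^ n] bounds
    the expression above by [(2 v) ^ (- n)]. *)
Lemma cvg_exp_one_sub_exp_large (v : R) : 2^-1 < v <= 1 ->
  (fun n => (1 - v ^+ n) ^+ (2 ^ n)) @ \oo --> (0 : R).
Proof.
move=> /andP[v0 v1].
have bern (w : R) k : 0 <= w -> k%:R * w <= (1 + w) ^+ k.
  move=> w0; suff : 1 + k%:R * w <= (1 + w) ^+ k by lra.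
  elim: k => [|k IH]; first by rewrite mul0r addr0 expr0.
  have hk : (0 : R) <= k%:R by [].
  rewrite exprS; have : (1 + w) * (1 + k%:R * w) <= (1 + w) * (1 + w) ^+ k.
    by apply: ler_wpM2l => //; lra.
  by apply: le_trans; rewrite -natr1; nra.
have v2 : 0 < 2 * v by lra.
have c : (fun n => ((2 * v)^-1) ^+ n) @ \oo --> (0 : R).
  apply: cvg_expr; rewrite ger0_norm ?invr_ge0 ?ltW // invf_lt1 //; lra.
apply: squeeze_cvgr (cvg_cst (0 : R)) c.
near=> n; have vn : 0 <= v ^+ n <= 1.
  by rewrite exprn_ge0 ?exprn_ile1 //; lra.
case/andP: vn => vn0 vn1.
have h1 : 0 <= (1 - v ^+ n) ^+ (2 ^ n) by apply: exprn_ge0; lra.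
rewrite h1 /= exprVn -[leRHS]mulr1 ler_pdivlMl ?exprn_gt0 //.
have : (2 * v) ^+ n <= (1 + v ^+ n) ^+ (2 ^ n).
  by have := bern _ (2 ^ n)%N vn0; rewrite exprMn natrX.
move=> /(ler_wpM2r h1) /le_trans; apply.
rewrite -exprMn; apply: exprn_ile1; nra.
Unshelve. all: by end_near. Qed.


(** With [v = (1 - g) / 2] and [g x = sin (pi (x - b) / T) sin (pi (y - x) / T)],
    a trigonometric polynomial that is positive on [(b, y)] and negative on the
    rest of the period, the trigonometric polynomials [(1 - v ^ n) ^ (2 ^ n)]
    converge boundedly to the indicator of [(b, y)]. *)
Lemma trig_orthogonal_itv (b T : R) u (y : R) : b < y < b + T ->
  trig_orthogonal (2 * pi / T) `[b, b + T[ u ->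
  \int[lam]_(x in `]b, y[) u x = 0.
Proof.
move=> /andP[by_ yT] zu; have T0 : 0 < T by lra.
have p0 : 0 < pi :> R := pi_gt0 R.
have [iu _] := zu.
set D := `[b, b + T[%classic : set (measurableTypeR R).
have mD : measurable D by exact: measurable_itv.
pose g x := sin (pi / T * (x - b)) * sin (pi / T * (y - x)).
pose v x := (1 - g x) / 2.
have gE x : g x = 2^-1 * cos (2 * pi / T * x - pi / T * (b + y)) -
                  2^-1 * cos (pi / T * (y - b)).
  rewrite /g; set A := pi / T * (x - b); set B := pi / T * (y - x).
  have -> : 2 * pi / T * x - pi / T * (b + y) = A - B by rewrite /A /B; ring.
  have -> : pi / T * (y - b) = A + B by rewrite /A /B; ring.
  by rewrite (cosD A B) (cosB A B); field.
have hv h : trig_orthogonal (2 * pi / T) D h ->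
    trig_orthogonal (2 * pi / T) D (fun x => h x * v x).
  move=> zh; have z1 := trig_orthogonalZ
    (2^-1 + 4^-1 * cos (pi / T * (y - b))) mD zh.
  have z2 := trig_orthogonalZ (- 4^-1) mD
    (trig_orthogonal_mul_cos (- (pi / T * (b + y))) mD zh).
  have := trig_orthogonalD mD z1 z2.
  by apply: eq_trig_orthogonal => x; rewrite /v gE; field.
pose p n x := (1 - v x ^+ n) ^+ (2 ^ n).
have zp n : trig_orthogonal (2 * pi / T) D (fun x => u x * p n x).
  exact: trig_orthogonal_mul_exp.
have v01 x : 0 <= v x <= 1.
  rewrite /v; have : `|g x| <= 1.
    by rewrite normrM; apply: mulr_ile1 => //; exact: normr_sin_le1.
  by rewrite ler_norml => /andP[]; lra.
have p01 n x : 0 <= p n x <= 1.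
  have /andP[v0 v1] := v01 x.
  have h0 : 0 <= v x ^+ n by exact: exprn_ge0.
  have h1 : v x ^+ n <= 1 by exact: exprn_ile1.
  by rewrite /p exprn_ge0 ?exprn_ile1 //; lra.
have angle (z : R) : 0 < z < T -> 0 < pi / T * z < pi.
  move=> /andP[z0 zT]; rewrite !mulr_gt0 ?invr_gt0 //=.
  by rewrite mulrAC ltr_pdivrMr // ltr_pM2l.
have pcvg x : D x -> x != b -> x != y ->
    (fun n => p n x) @ \oo --> (\1_(`]b, y[%classic : set R) x : R).
  rewrite /D /= in_itv /= => /andP[bx xT] xb xy.
  have {xb}bx : b < x by rewrite lt_neqAle eq_sym xb.
  have s1 : 0 < sin (pi / T * (x - b)) by apply/sin_gt0_pi/angle; lra.
  case: (ltgtP x y) xy => // xy _.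
    rewrite indicE mem_set /= ?in_itv /= ?bx //.
    have s2 : 0 < sin (pi / T * (y - x)) by apply/sin_gt0_pi/angle; lra.
    apply: cvg_exp_one_sub_exp_small.
    have : 0 < g x by exact: mulr_gt0.
    by have := v01 x; rewrite /v; lra.
  rewrite indicE memNset /= ?in_itv /= ?bx ?(lt_gtF xy) //.
  have s2 : 0 < sin (pi / T * (x - y)) by apply/sin_gt0_pi/angle; lra.
  apply: cvg_exp_one_sub_exp_large.
  have : g x < 0.
    rewrite /g -[y - x]opprB mulrN sinN mulrN oppr_lt0; exact: mulr_gt0.
  by have := v01 x; rewrite /v; lra.
have iI : lam.-integrable D
    (EFin \o (fun x => u x * \1_(`]b, y[%classic : set R) x)).
  apply: (@integrable_mul_bounded D u _ 1) => //.
  by move=> x _; rewrite indicE; case: (_ \in _); rewrite ?normr1 ?normr0.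
have [] := @dominated_convergence _ _ _ lam D mD
   (fun n => EFin \o (fun x => u x * p n x))
   (EFin \o (fun x => u x * \1_(`]b, y[%classic : set R) x))
   (fun x => `|(u x)%:E|%E).
- by move=> n; exact: measurable_int (zp n).1.
- exact: measurable_int iI.
- exists ([set b] `|` [set y]); split; first exact: measurableU.
    by rewrite null_set_setU //; exact: lebesgue_measure_set1.
  move=> x /= /not_implyP[Dx nx]; apply: contrapT => /not_orP[xb xy]; apply: nx.
  apply: cvg_EFin; first exact: nearW.
  by apply: cvgM; [exact: cvg_cst|apply: pcvg => //; exact/eqP].
- exact: integrable_abse.
- apply: aeW => x n Dx /=.
  rewrite lee_fin normrM ler_piMr // ger0_norm; by have /andP[] := p01 n x.
move=> _ _.
have -> : (fun n => \int[lam]_(x in D) (EFin \o (fun x => u x * p n x)%R) x)%E =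
   cst 0%E.
  apply/funext => n /=.
  have := (zp n).2 0 0.
  under eq_Rintegral do rewrite mulr0 mul0r addr0 cos0 mulr1.
  rewrite /Rintegral => h0.
  rewrite -[LHS]fineK ?h0 //; exact: (integrable_fin_num mD (zp n).1).
move=> /(cvg_unique (@ereal_hausdorff R) (cvg_cst _)) h0.
have e1 : `]b, y[%classic = D `&` `]b, y[%classic.
  apply/seteqP; split => x /=; last by case.
  rewrite /D /= !in_itv /= => /andP[bx xy]; rewrite bx xy (ltW bx) /=; split=> //.
  exact: lt_trans yT.
rewrite e1 Rintegral_mkcondr /Rintegral.
rewrite (_ : (\int[lam]_(x in D) _)%E = 0%E) //.
rewrite h0; apply: eq_integral => x _ /=.
by rewrite patchE indicE; case: ifPn; rewrite ?mulr1 ?mulr0.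
Qed.

(** A function orthogonal to all trigonometric polynomials has a vanishing
    antiderivative, hence vanishes by Lebesgue's differentiation theorem. *)
Lemma trig_orthogonal_eq0 (b T : R) u : 0 < T ->
  trig_orthogonal (2 * pi / T) `[b, b + T[ u ->
  {ae lam, forall x, `[b, b + T[%classic x -> u x = 0}.
Proof.
move=> T0 zu; have [iu u0] := zu.
set D := `[b, b + T[%classic : set (measurableTypeR R).
have mD : measurable D by exact: measurable_itv.
pose w := u \_ D.
have iw : lam.-integrable setT (EFin \o w).
  by rewrite /w -restrict_EFin; apply/(integrable_mkcond _ mD).
have F0 z : \int[lam]_(t in `]-oo, z]) w t = 0.
  rewrite /w -Rintegral_mkcondr.
  have [zb|bz] := ltP z b.
    rewrite (_ : _ `&` _ = set0) ?Rintegral_set0 //.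
    by apply/seteqP; split => x //=; rewrite /D /= !in_itv /=; lra.
  have [zT|Tz] := ltP z (b + T); last first.
    rewrite (_ : _ `&` _ = D).
      have := u0 0 0; by under eq_Rintegral do rewrite mulr0 mul0r addr0 cos0 mulr1.
    by apply/seteqP; split => x /=; rewrite /D /= !in_itv /=; [lra|lra].
  rewrite (_ : _ `&` _ = `[b, z]%classic); last first.
    by apply/seteqP; split => x /=; rewrite /D /= !in_itv /=; [lra|lra].
  have [->|zb] := eqVneq z b; first by rewrite set_itv1 Rintegral_set1.
  have bz' : b < z by rewrite lt_neqAle eq_sym zb.
  have := @trig_orthogonal_itv b T u z; rewrite bz' zT => /(_ isT zu) <-.
  rewrite /Rintegral integral_itv_bndoo //.
  have mu_ : measurable_fun D (EFin \o u) := measurable_int _ iu.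
  apply: measurable_funS mD _ mu_ => x /=.
  by rewrite /D /= !in_itv /= => /andP[bx xz]; rewrite (ltW bx) (lt_trans xz zT).
have loc : locally_integrable [set: R] w.
  split; first by apply/measurable_EFinP; exact: measurable_int iw.
    exact: openT.
  move=> K _ cK; have mK : measurable (K : set (measurableTypeR R)).
    exact: compact_measurable.
  have /integrableP[_] := integrableS measurableT mK (@subsetT _ _) iw.
  by [].
have iwy y : lam.-integrable `]-oo, y] (EFin \o w).
  by apply: integrableS iw; [exact: measurableT|exact: measurable_itv|exact: subsetT].
have := FTC1Ny iwy loc.
apply: ae_mono => x [_ dF] Dx.
rewrite (_ : u x = w x); last by rewrite /w patchE mem_set.
rewrite -dF (_ : (fun x0 : R => _) = cst 0); last exact/funext.
by rewrite derive1_cst.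
Qed.

End Uniqueness.

(** * Dilation of integrals *)

Section Dilation.
Context {R : realType}.
Local Notation lam := (@lebesgue_measure R).
Local Notation dil c := (fun x : measurableTypeR R => (c * x)%R : measurableTypeR R).
Implicit Types (D A : set (measurableTypeR R)) (c x : R).

Lemma measurable_mull c : measurable_fun setT (dil c).
Proof. exact: mulrl_measurable. Qed.

Lemma measurable_dilation_preimage c A :
  measurable A -> measurable ((dil c) @^-1` A).
Proof. by move=> mA; rewrite -[X in measurable X]setTI; exact: measurable_mull. Qed.

(** Lebesgue measure is determined by its values on intervals. *)
Lemma lebesgue_measure_dilation c A (c0 : 0 < c) : measurable A ->
  (c%:E * lam ((dil c) @^-1` A) = lam A)%E.
Proof.
move=> mA.
have := @lebesgue_measure_unique R (mscale (NngNum (ltW c0))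
  (pushforward lam (dil c))).
move=> /(_ (measurable_mull c) _ A mA) -> // _ [[x y]] _ <-.
have E : (dil c) @^-1` `]x, y]%classic = `](x / c), (y / c)]%classic.
  apply/seteqP; split => z /=;
    by rewrite !in_itv /= ltr_pdivrMr // ler_pdivlMr // mulrC.
transitivity (c%:E * lam `](x / c)%R, (y / c)%R]%classic)%E; last by rewrite -E.
rewrite !lebesgue_measure_itv /= !lte_fin ltr_pM2r ?invr_gt0 //.
case: ifPn => _; last by rewrite mule0.
by rewrite -!EFinD -EFinM; congr EFin; field; rewrite gt_eqF.
Qed.

Lemma ge0_integral_dilation c D (f : R -> \bar R) : 0 < c ->
  measurable D -> measurable_fun D (f : measurableTypeR R -> \bar R) ->
  (forall x, D x -> 0 <= f x)%E ->
  (\int[lam]_(x in D) f x = c%:E * \int[lam]_(x in [set x | D (c * x)%R]) f (c * x)%R)%E.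
Proof.
move=> c0 mD mf f0.
have := @eq_measure_integral _ _ R D (mscale (NngNum (ltW c0))
  (pushforward lam (dil c))) lam f.
move=> /(_ (measurable_mull c)) ->; last first.
  by move=> A mA _ /=; rewrite -(lebesgue_measure_dilation c0 mA).
rewrite ge0_integral_mscale //=; congr (_ * _)%E.
rewrite ge0_integral_pushforward //.
  exact: measurable_mull.
by move=> x; rewrite inE => /f0.
Qed.

Lemma measurable_fun_dilation c D d' (T' : measurableType d') (f : R -> T') :
  measurable D -> measurable_fun D (f : measurableTypeR R -> T') ->
  measurable_fun [set x : measurableTypeR R | D (c * x)]
    (fun x : measurableTypeR R => f (c * x)).
Proof.
move=> mD mf; apply: (@measurable_comp _ _ _ _ _ _ D) => //.
by move=> _ [x Dx <-].
Qed.

Lemma integrable_dilation c D (f : R -> R) : 0 < c -> measurable D ->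
  lam.-integrable D (EFin \o f) ->
  lam.-integrable [set x : measurableTypeR R | D (c * x)] (EFin \o (fun x => f (c * x))).
Proof.
move=> c0 mD /integrableP[mf fy]; apply/integrableP; split.
  by have := measurable_fun_dilation (c := c) mD mf.
move: fy; rewrite (ge0_integral_dilation c0 mD) //; last exact: measurableT_comp.
by move=> cI; rewrite -(@lte_pmul2l _ c%:E) // gt0_muley.
Qed.

Lemma Rintegral_dilation c D (f : R -> R) : 0 < c -> measurable D ->
  lam.-integrable D (EFin \o f) ->
  \int[lam]_(x in D) f x = c * \int[lam]_(x in [set x | D (c * x)]) f (c * x).
Proof.
move=> c0 mD fi; have ficD := integrable_dilation c0 mD fi.
have mf := measurable_int _ fi.
have mcD := @measurable_dilation_preimage c _ mD.
rewrite /Rintegral integralE [X in _ = _ * fine X]integralE.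
rewrite (ge0_integral_dilation c0 mD (measurable_funepos mf)) //.
rewrite (ge0_integral_dilation c0 mD (measurable_funeneg mf)) //.
have f1 := integrable_fin_num mcD (integrable_funepos mcD ficD).
have f2 := integrable_fin_num mcD (integrable_funeneg mcD ficD).
have Ep : (fun x : measurableTypeR R => (EFin \o f)^\+ (c * x)%R)%E =
    ((EFin \o (fun x => f (c * x)%R))^\+)%E.
  by apply/funext => x; rewrite !funeposE.
have En : (fun x : measurableTypeR R => (EFin \o f)^\- (c * x)%R)%E =
    ((EFin \o (fun x => f (c * x)%R))^\-)%E.
  by apply/funext => x; rewrite !funenegE.
rewrite Ep En -muleBr ?fineM //.
- by rewrite fin_numB; apply/andP; split; [exact: f1|exact: f2].
- exact: fin_num_adde_defr f1.
Qed.

End Dilation.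

(** * Dilation periods and periodization *)

Section Periodization.
Context {R : realType}.
Local Notation lam := (@lebesgue_measure R).
Local Notation mR := (measurableTypeR R).
Variables (a b : R) (a1 : 1 < a) (b0 : 0 < b).

Let a0 : 0 < a. Proof. exact: lt_trans a1. Qed.

Let al0 (l : int) : 0 < a ^ l. Proof. exact: exprz_gt0. Qed.

Lemma expfz_succ (l : int) : a ^ (l + 1) = a * a ^ l.
Proof. by rewrite expfzDr ?gt_eqF // expr1z mulrC. Qed.

Lemma dilation_indexP (x : R) : 0 < x ->
  a ^ dilation_index a x <= x < a ^ (dilation_index a x + 1).
Proof.
move=> x0; have lna : 0 < ln a by rewrite ln_gt0.
rewrite /dilation_index; set t := ln x / ln a.
have xE : x = a `^ t.
  by rewrite /powR gt_eqF // /t divfK ?gt_eqF // lnK.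
suff : a `^ (Num.floor t)%:~R <= a `^ t < a `^ (Num.floor t + 1)%:~R.
  by rewrite -xE !powR_intmul ?(ltW a0).
by rewrite /powR (gt_eqF a0) ler_expR ltr_expR ler_pM2r // ltr_pM2r //;
  exact: Num.Theory.floor_itv.
Qed.

Lemma dilation_index_def (x : R) (j : int) :
  a ^ j <= x < a ^ (j + 1) -> dilation_index a x = j.
Proof.
move=> /andP[jx xj]; have x0 : 0 < x by exact: lt_le_trans jx.
have /andP[ix xi] := dilation_indexP x0; set i := dilation_index a x in ix xi *.
have h1 : (i < j + 1).
  by rewrite -(ltr_eXz2l a1); exact: le_lt_trans xj.
have h2 : (j < i + 1).
  by rewrite -(ltr_eXz2l a1); exact: le_lt_trans xi.
by apply/eqP; rewrite eq_le -!ltzD1 h1.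
Qed.

(** The union of the dilates of the period [[b, a b)] by [a ^ j] for
    [- N <= j <= N]. *)
Definition shell (N : nat) : set mR := `[a ^ (- N%:Z) * b, a ^ (N%:Z + 1) * b[.

Definition periodize (k : R -> R) (N : nat) (x : R) : R :=
  \sum_(i < (2 * N).+1) a ^ (i%:Z - N%:Z) * k (a ^ (i%:Z - N%:Z) * x).

Lemma measurable_shell N : measurable (shell N).
Proof. exact: measurable_itv. Qed.

Lemma nondecreasing_shell : {homo shell : n m / (n <= m)%N >-> (n <= m)%O}.
Proof.
move=> n m nm; apply/subsetPset => x; rewrite /shell /= !in_itv /= => /andP[h1 h2].
apply/andP; split.
  apply: le_trans h1; rewrite ler_pM2r // ler_eXz2l //; lia.
apply: lt_le_trans h2 _; rewrite ler_pM2r // ler_eXz2l //; lia.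
Qed.

Lemma shell_subset N : shell N `<=` Rplus R.
Proof.
move=> x; rewrite /shell /Rplus /= !in_itv /= andbT => /andP[h _].
by apply: lt_le_trans h; rewrite mulr_gt0.
Qed.

Lemma bigcup_shell : \bigcup_N shell N = Rplus R.
Proof.
apply/seteqP; split => [x [N _] /shell_subset //|x].
rewrite /Rplus /= in_itv /= andbT => x0.
have xb0 : 0 < x / b by rewrite divr_gt0.
have := dilation_indexP xb0; set j := dilation_index _ _ => /andP[h1 h2].
exists `|j|%N => //; rewrite /shell /= in_itv /= -ler_pdivlMr // -ltr_pdivrMr //.
apply/andP; split.
  by apply: le_trans h1; rewrite ler_eXz2l //; lia.
by apply: lt_le_trans h2 _; rewrite ler_eXz2l //; lia.
Qed.

Lemma period_subset (l m : int) : `[a ^ l * b, a ^ m * b[%classic `<=` Rplus R.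
Proof.
move=> x; rewrite /Rplus /= !in_itv /= andbT => /andP[h _].
by apply: lt_le_trans h; rewrite mulr_gt0.
Qed.

Lemma measurable_Rplus : measurable (Rplus R).
Proof. exact: measurable_itv. Qed.
Hint Resolve measurable_Rplus : core.

Lemma dilated_period (l : int) :
  [set x : mR | `[a ^ l * b, a ^ (l + 1) * b[%classic (a ^ l * x)] = `[b, a * b[%classic.
Proof.
have E : a ^ (l + 1) * b = a ^ l * (a * b) by rewrite expfz_succ; ring.
by apply/seteqP; split => x /=; rewrite !in_itv /= E ler_pM2l // ltr_pM2l.
Qed.

Lemma dilated_Rplus (c : R) : 0 < c -> [set x : mR | Rplus R (c * x)] = Rplus R.
Proof.
by move=> c0; apply/seteqP; split => x; rewrite /Rplus /= !in_itv /= !andbT pmulr_rgt0.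
Qed.

Lemma measurable_dilated (c : R) d' (T' : measurableType d') (k : R -> T') : 0 < c ->
  measurable_fun (Rplus R) (k : mR -> T') ->
  measurable_fun (Rplus R) (fun x : mR => k (c * x)).
Proof.
move=> c0 mk; rewrite -[X in measurable_fun X](dilated_Rplus c0).
exact: measurable_fun_dilation.
Qed.

Lemma period1_subset : `[b, a * b[%classic `<=` Rplus R.
Proof.
move=> x; rewrite /Rplus /= !in_itv /= andbT => /andP[h _]; exact: lt_le_trans h.
Qed.

Lemma consecutive_periods (s : int) (n : nat) :
  `[a ^ s * b, a ^ (s + n.+1%:Z) * b[%classic =
  `[a ^ s * b, a ^ (s + n%:Z) * b[%classic `|`
  `[a ^ (s + n%:Z) * b, a ^ (s + n%:Z + 1) * b[%classic :> set mR.
Proof.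
rewrite (_ : s + n.+1%:Z = s + n%:Z + 1); last by lia.
apply: itv_bndbnd_setU; rewrite bnd_simp ler_pM2r // ler_eXz2l //; lia.
Qed.

Lemma consecutive_periods_disj (s : int) (n : nat) :
  [disjoint `[a ^ s * b, a ^ (s + n%:Z) * b[%classic : set mR &
  `[a ^ (s + n%:Z) * b, a ^ (s + n%:Z + 1) * b[%classic].
Proof.
apply/disj_setPS => x [/=]; rewrite !in_itv /= => /andP[_ h] /andP[h' _].
by have := lt_le_trans h h'; rewrite ltxx.
Qed.

Lemma ge0_integral_periods (k : R -> R) (s : int) (n : nat) :
  measurable_fun (Rplus R) (k : mR -> mR) -> (forall x, 0 < x -> 0 <= k x) ->
  (\int[lam]_(x in `[(a ^ s * b)%R, (a ^ (s + n%:Z) * b)%R[) (k x)%:E =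
   \int[lam]_(x in `[b, (a * b)%R[) (\sum_(i < n)
      a ^ (s + i%:Z) * k (a ^ (s + i%:Z) * x)%R)%R%:E)%E.
Proof.
move=> mk k0; have k0' x : Rplus R x -> 0 <= k x.
  by rewrite /Rplus /= in_itv /= andbT; exact: k0.
have mkE : measurable_fun (Rplus R) (fun x : mR => (k x)%:E) by exact/measurable_EFinP.
transitivity (\sum_(i < n) \int[lam]_(x in `[b, (a * b)%R[)
      ((a ^ (s + i%:Z) * k (a ^ (s + i%:Z) * x))%R)%:E)%E; last first.
  rewrite -ge0_integral_sum //=.
  - by apply: eq_integral => x _; rewrite sumEFin.
  - move=> i; apply/measurable_EFinP; apply: measurable_funM => //.
    have m1 := measurable_dilated (al0 (s + i%:Z)) mk.
    by apply: measurable_funS m1 => //; exact: period1_subset.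
  - move=> i x /period1_subset Rx; rewrite lee_fin mulr_ge0 ?(ltW (al0 _)) //; apply: k0'.
    by move: Rx; rewrite /Rplus /= !in_itv /= !andbT pmulr_rgt0.
elim: n => [|n IH].
  by rewrite addr0 set_itvco0 integral_set0 big_ord0.
rewrite big_ord_recr /= -IH consecutive_periods ge0_integral_setU //.
- congr (_ + _)%E.
  rewrite (@ge0_integral_dilation _ (a ^ (s + n%:Z))) //.
  + rewrite dilated_period -ge0_integralZl_EFin ?(ltW (al0 _)) //.
    * move=> x /period1_subset Rx; rewrite lee_fin; apply: k0'.
      by move: Rx; rewrite /Rplus /= !in_itv /= !andbT pmulr_rgt0.
    * have m1 := measurable_dilated (al0 (s + n%:Z)) mkE.
      by apply: measurable_funS m1 => //; exact: period1_subset.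
  + by apply: measurable_funS mkE => //; exact: period_subset.
  + by move=> x /period_subset Rx; rewrite lee_fin; exact: k0'.
- rewrite -consecutive_periods.
  by apply: measurable_funS mkE => //; exact: period_subset.
- rewrite -consecutive_periods => x /period_subset Rx; rewrite lee_fin; exact: k0'.
- exact: consecutive_periods_disj.
Qed.

Lemma Rintegral_periods (k : R -> R) (s : int) (n : nat) :
  lam.-integrable (Rplus R) (EFin \o k) ->
  \int[lam]_(x in `[a ^ s * b, a ^ (s + n%:Z) * b[) k x =
   \int[lam]_(x in `[b, a * b[) (\sum_(i < n)
      a ^ (s + i%:Z) * k (a ^ (s + i%:Z) * x)) /\
  lam.-integrable `[b, a * b[ (EFin \o (fun x => \sum_(i < n)
      a ^ (s + i%:Z) * k (a ^ (s + i%:Z) * x))).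
Proof.
move=> ik; elim: n => [|n [IH1 IH2]].
  rewrite addr0 set_itvco0 Rintegral_set0.
  under [in RHS]eq_Rintegral do rewrite big_ord0.
  rewrite Rintegral_cst // mul0r; split => //.
  apply: eq_integrable (integrable0 _ _) => // x _ /=.
  by rewrite big_ord0.
have ikn : lam.-integrable `[a ^ (s + n%:Z) * b, a ^ (s + n%:Z + 1) * b[
   (EFin \o k) by apply: integrableS ik => //; exact: period_subset.
have := integrable_dilation (al0 (s + n%:Z)) (measurable_itv _) ikn.
rewrite dilated_period => idk.
have idk' := integrableZ_EFin (a ^ (s + n%:Z)) (measurable_itv _) idk.
split; last first.
  apply: eq_integrable (integrableD_EFin (measurable_itv _) IH2 idk') => // x _ /=.
  by rewrite big_ord_recr.
under [in RHS]eq_Rintegral do rewrite big_ord_recr /=.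
rewrite RintegralD // -IH1 consecutive_periods Rintegral_setU //.
- congr (_ + _); rewrite (@Rintegral_dilation _ (a ^ (s + n%:Z))) //.
  by rewrite dilated_period RintegralZl.
- rewrite -consecutive_periods; apply: integrableS ik => //; exact: period_subset.
- exact: consecutive_periods_disj.
Qed.

Let shellE N : shell N = `[a ^ (- N%:Z) * b, a ^ (- N%:Z + (2 * N).+1%:Z) * b[%classic.
Proof. by rewrite /shell (_ : - N%:Z + (2 * N).+1%:Z = N%:Z + 1) //; lia. Qed.

Let periodizeE k N : periodize k N = fun x => \sum_(i < (2 * N).+1)
   a ^ (- N%:Z + i%:Z) * k (a ^ (- N%:Z + i%:Z) * x).
Proof. by apply/funext => x; apply: eq_bigr => i _; rewrite addrC. Qed.

(** The dilates of a period tile the half-line, and a change of variables brings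
    each of them back to the period. *)
Lemma ge0_integral_periodize (k : R -> R) :
  measurable_fun (Rplus R) (k : mR -> mR) -> (forall x, 0 < x -> 0 <= k x) ->
  (\int[lam]_(x in `[b, (a * b)%R[) (periodize k N x)%:E @[N --> \oo] -->
  \int[lam]_(x in Rplus R) (k x)%:E)%E.
Proof.
move=> mk k0.
rewrite (_ : (fun N => _) = (fun N => \int[lam]_(x in shell N) (k x)%:E)%E); last first.
  by apply/funext => N; rewrite shellE periodizeE ge0_integral_periods.
rewrite -bigcup_shell; apply: ge0_nondecreasing_set_cvg_integral.
- exact: nondecreasing_shell.
- exact: measurable_shell.
- move=> N; apply/measurable_EFinP.
  exact: measurable_funS (@shell_subset N) mk.
- move=> N x /shell_subset; rewrite /Rplus /= in_itv /= andbT lee_fin; exact: k0.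
Qed.

Lemma ge0_integral_periodize_le (k : R -> R) N :
  measurable_fun (Rplus R) (k : mR -> mR) -> (forall x, 0 < x -> 0 <= k x) ->
  (\int[lam]_(x in `[b, (a * b)%R[) (periodize k N x)%:E <=
  \int[lam]_(x in Rplus R) (k x)%:E)%E.
Proof.
move=> mk k0; rewrite periodizeE -ge0_integral_periods // -shellE.
apply: ge0_subset_integral => //; first exact: measurable_shell.
- exact/measurable_EFinP.
- by move=> x; rewrite /Rplus /= in_itv /= andbT lee_fin; exact: k0.
- exact: shell_subset.
Qed.

Lemma Rintegral_periodize (k : R -> R) :
  lam.-integrable (Rplus R) (EFin \o k) ->
  \int[lam]_(x in `[b, a * b[) periodize k N x @[N --> \oo] -->
  \int[lam]_(x in Rplus R) k x.
Proof.
move=> ik; have mk := measurable_int _ ik.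
have mk' : measurable_fun (Rplus R) (k : mR -> mR) by exact/measurable_EFinP.
rewrite (_ : (fun N => _) = (fun N => \int[lam]_(x in Rplus R) (k \_ (shell N)) x)); last first.
  apply/funext => N; rewrite periodizeE -(Rintegral_periods _ _ ik).1 -shellE.
  by rewrite -Rintegral_mkcondr; congr Rintegral; rewrite setIidr //; exact: shell_subset.
apply: fine_cvg; rewrite /Rintegral fineK; last exact: integrable_fin_num.
have [] := @dominated_convergence _ _ _ lam (Rplus R) measurable_Rplus
   (fun N => EFin \o (k \_ (shell N))) (EFin \o k) (fun x => `|(k x)%:E|%E).
- move=> N; apply/measurable_EFinP; apply/measurable_restrict => //.
    exact: measurable_shell.
  by apply: measurable_funS mk' => //; exact: subIsetl.
- by [].
- apply: aeW => x; rewrite -bigcup_shell => -[M _ xM].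
  apply: cvg_near_cst; exists M => // N /= MN; rewrite patchE mem_set //.
  have /subsetPset := nondecreasing_shell MN; exact.
- exact: integrable_abse.
- apply: aeW => x N _ /=; rewrite lee_fin patchE; case: ifPn => // _.
  by rewrite normr0.
by move=> _ _.
Qed.

End Periodization.

Local Notation Rez := complex.Re.
Local Notation Imz := complex.Im.
Local Notation normc := ComplexField.Normc.normc.

(** * Complex-valued functions *)

Section ComplexAlgebra.
Context {R : realType}.
Implicit Types z w : R[i].

Lemma re_add z w : Rez (z + w) = Rez z + Rez w. Proof. by case: z; case: w. Qed.
Lemma im_add z w : Imz (z + w) = Imz z + Imz w. Proof. by case: z; case: w. Qed.
Lemma re_opp z : Rez (- z) = - Rez z. Proof. by case: z. Qed.
Lemma im_opp z : Imz (- z) = - Imz z. Proof. by case: z. Qed.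
Lemma re_mul z w : Rez (z * w) = Rez z * Rez w - Imz z * Imz w.
Proof. by case: z; case: w. Qed.
Lemma im_mul z w : Imz (z * w) = Rez z * Imz w + Imz z * Rez w.
Proof. by case: z; case: w. Qed.
Lemma re_conj z : Rez (conjc z) = Rez z. Proof. by case: z. Qed.
Lemma im_conj z : Imz (conjc z) = - Imz z. Proof. by case: z. Qed.
Lemma Re_sum (I : Type) (r : seq I) (P : pred I) (F : I -> R[i]) :
  Rez (\sum_(i <- r | P i) F i) = \sum_(i <- r | P i) Rez (F i).
Proof. by apply: (big_morph _ re_add). Qed.
Lemma Im_sum (I : Type) (r : seq I) (P : pred I) (F : I -> R[i]) :
  Imz (\sum_(i <- r | P i) F i) = \sum_(i <- r | P i) Imz (F i).
Proof. by apply: (big_morph _ im_add). Qed.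

Lemma conj_mul z w : conjc (z * w) = conjc z * conjc w.
Proof. exact: rmorphM. Qed.

Lemma conj_sum (I : Type) (r : seq I) (F : I -> R[i]) :
  conjc (\sum_(i <- r) F i) = \sum_(i <- r) conjc (F i).
Proof. exact: rmorph_sum. Qed.

Lemma complex_ext z w : Rez z = Rez w -> Imz z = Imz w -> z = w.
Proof. by case: z => a b; case: w => c d /= -> ->. Qed.

Lemma normc_sqE z : normc z ^+ 2 = Rez z ^+ 2 + Imz z ^+ 2.
Proof. by case: z => x y /=; rewrite sqr_sqrtr // addr_ge0 ?sqr_ge0. Qed.

Lemma normc_sq_eq0 z : normc z ^+ 2 = 0 -> z = 0.
Proof. by move/eqP; rewrite sqrf_eq0 => /eqP /ComplexField.Normc.eq0_normc. Qed.

Lemma normc_sqM z w : normc (z * w) ^+ 2 = normc z ^+ 2 * normc w ^+ 2.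
Proof. by rewrite ComplexField.Normc.normcM exprMn. Qed.

Lemma normc_sqJ z : normc (conjc z) ^+ 2 = normc z ^+ 2.
Proof. by rewrite !normc_sqE re_conj im_conj sqrrN. Qed.

Lemma normc_sqC (x : R) : normc x%:C ^+ 2 = x ^+ 2.
Proof. by rewrite normc_sqE /= expr0n addr0. Qed.

Lemma normc_sqB z w :
  normc (z - w) ^+ 2 = normc z ^+ 2 + (- 2) * Rez (z * conjc w) + normc w ^+ 2.
Proof. by rewrite !normc_sqE re_mul re_conj im_conj !re_add !im_add !re_opp !im_opp; ring. Qed.

Lemma normc_sqD_le z w : normc (z + w) ^+ 2 <= 2 * normc z ^+ 2 + 2 * normc w ^+ 2.
Proof.
have : 0 <= normc (z - w) ^+ 2 by rewrite sqr_ge0.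
by rewrite !normc_sqE !re_add !im_add !re_opp !im_opp; nra.
Qed.

(** Young's inequality; the weight [t] replaces the Cauchy-Schwarz inequality in
    limit arguments, where one factor is small and the other one bounded. *)
Lemma normr_ReM_le (t : R) z w : 0 < t ->
  `|Rez (z * w)| <= t * normc z ^+ 2 + t^-1 * normc w ^+ 2.
Proof.
move=> t0; rewrite !normc_sqE re_mul.
set x := Rez z; set y := Imz z; set p := Rez w; set q := Imz w.
have s0 : 0 < t^-1 by rewrite invr_gt0.
have e x' p' : `|x' * p'| <= t * x' ^+ 2 + t^-1 * p' ^+ 2.
  have h1 : 0 <= t^-1 * (t * x' - p') ^+ 2 by rewrite mulr_ge0 ?sqr_ge0 ?ltW.
  have h2 : 0 <= t^-1 * (t * x' + p') ^+ 2 by rewrite mulr_ge0 ?sqr_ge0 ?ltW.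
  have e1 : t^-1 * (t * x' - p') ^+ 2 = t * x' ^+ 2 + t^-1 * p' ^+ 2 - 2 * (x' * p').
    by field; rewrite gt_eqF.
  have e2 : t^-1 * (t * x' + p') ^+ 2 = t * x' ^+ 2 + t^-1 * p' ^+ 2 + 2 * (x' * p').
    by field; rewrite gt_eqF.
  have h3 : 0 <= t * x' ^+ 2 + t^-1 * p' ^+ 2.
    by rewrite addr_ge0 // mulr_ge0 ?sqr_ge0 ?ltW.
  by rewrite ler_norml; apply/andP; split; lra.
apply: le_trans (ler_normB _ _) _.
by have := e x p; have := e y q; lra.
Qed.

Lemma normr_ImM_le (t : R) z w : 0 < t ->
  `|Imz (z * w)| <= t * normc z ^+ 2 + t^-1 * normc w ^+ 2.
Proof.
move=> t0; have := normr_ReM_le z (w * 'i) t0.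
rewrite mulrA re_mul /= mulr0 mulr1 sub0r normrN normc_sqM.
by rewrite (_ : normc 'i ^+ 2 = 1) ?mulr1 // normc_sqE /= expr0n expr1n add0r.
Qed.

Lemma expiD (x y : R) : expi (x + y) = expi x * expi y.
Proof.
apply: complex_ext; rewrite ?re_mul ?im_mul /= ?cosD ?sinD //.
by rewrite addrC [X in X + _]mulrC [X in _ + X]mulrC addrC.
Qed.

Lemma expiN (x : R) : expi (- x) = conjc (expi x).
Proof. by rewrite /expi cosN sinN. Qed.

Lemma expi0 : expi 0 = 1 :> R[i].
Proof. by rewrite /expi cos0 sin0. Qed.

Lemma normc_expi (x : R) : normc (expi x) ^+ 2 = 1.
Proof. by rewrite normc_sqE /= cos2Dsin2. Qed.

End ComplexAlgebra.

Section ComplexMeasurable.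
Context d (T : measurableType d) {R : realType} (D : set T).
Implicit Types f g : T -> R[i].

Lemma cmeasurable_cst (z : R[i]) : cmeasurable D (fun=> z).
Proof. by split; exact: measurable_cst. Qed.

Lemma cmeasurableD f g : cmeasurable D f -> cmeasurable D g ->
  cmeasurable D (fun x => f x + g x).
Proof.
move=> [f1 f2] [g1 g2]; split.
- by under eq_fun do rewrite re_add; exact: measurable_funD.
- by under eq_fun do rewrite im_add; exact: measurable_funD.
Qed.

Lemma cmeasurableM f g : cmeasurable D f -> cmeasurable D g ->
  cmeasurable D (fun x => f x * g x).
Proof.
move=> [f1 f2] [g1 g2]; split.
- by under eq_fun do rewrite re_mul; apply: measurable_funB; exact: measurable_funM.
- by under eq_fun do rewrite im_mul; apply: measurable_funD; exact: measurable_funM.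
Qed.

Lemma cmeasurableB f g : cmeasurable D f -> cmeasurable D g ->
  cmeasurable D (fun x => f x - g x).
Proof.
move=> [f1 f2] [g1 g2]; split.
- by under eq_fun do rewrite re_add re_opp; exact: measurable_funB.
- by under eq_fun do rewrite im_add im_opp; exact: measurable_funB.
Qed.

Lemma cmeasurableJ f : cmeasurable D f -> cmeasurable D (fun x => conjc (f x)).
Proof.
move=> [f1 f2]; split.
- by under eq_fun do rewrite re_conj.
- by under eq_fun do rewrite im_conj; exact: measurable_funN.
Qed.

Lemma cmeasurable_sum (I : Type) (s : seq I) (h : I -> T -> R[i]) :
  (forall i, cmeasurable D (h i)) -> cmeasurable D (fun x => \sum_(i <- s) h i x).
Proof.
move=> mh; split.
- by under eq_fun do rewrite Re_sum; apply: measurable_sum => i; exact: (mh i).1.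
- by under eq_fun do rewrite Im_sum; apply: measurable_sum => i; exact: (mh i).2.
Qed.

Lemma measurable_normc_sq f : cmeasurable D f ->
  measurable_fun D (fun x => normc (f x) ^+ 2 : measurableTypeR R).
Proof.
move=> [f1 f2]; under eq_fun do rewrite normc_sqE.
by apply: measurable_funD; exact: measurable_funX.
Qed.

Lemma cmeasurable_RC (h : T -> R) : measurable_fun D (h : T -> measurableTypeR R) ->
  cmeasurable D (fun x => (h x)%:C).
Proof. by move=> mh; split => //=; exact: measurable_cst. Qed.

Lemma cmeasurable_expi (h : T -> R) : measurable_fun D (h : T -> measurableTypeR R) ->
  cmeasurable D (fun x => expi (h x)).
Proof.
move=> mh; split => /=.
- apply: (@measurableT_comp _ _ _ _ _ _ (cos : measurableTypeR R -> measurableTypeR R)) => //.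
  by apply: continuous_measurable_fun; exact: continuous_cos.
- apply: (@measurableT_comp _ _ _ _ _ _ (sin : measurableTypeR R -> measurableTypeR R)) => //.
  by apply: continuous_measurable_fun; exact: continuous_sin.
Qed.

End ComplexMeasurable.

Lemma cmeasurableS d (T : measurableType d) (R : realType) (D E : set T) (f : T -> R[i]) :
  measurable D -> E `<=` D -> cmeasurable D f -> cmeasurable E f.
Proof. by move=> mD ED [f1 f2]; split; exact: measurable_funS ED _. Qed.

Section ComplexIntegral.
Context {R : realType}.
Local Notation lam := (@lebesgue_measure R).
Local Notation mR := (measurableTypeR R).
Variables (D : set mR) (mD : measurable D).
Implicit Types f g : R -> R[i].

Definition cintegrable f : Prop :=
  lam.-integrable D (EFin \o (fun x => Rez (f x))) /\
  lam.-integrable D (EFin \o (fun x => Imz (f x))).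

Lemma eq_cintegral f g : (forall x, D x -> f x = g x) -> cintegral D f = cintegral D g.
Proof.
by move=> fg; congr (_ +i* _); apply: eq_Rintegral => x; rewrite inE => /fg ->.
Qed.

Lemma Re_cintegral f : Rez (cintegral D f) = \int[lam]_(x in D) Rez (f x).
Proof. by []. Qed.

Lemma Im_cintegral f : Imz (cintegral D f) = \int[lam]_(x in D) Imz (f x).
Proof. by []. Qed.

Lemma cintegrableD f g : cintegrable f -> cintegrable g ->
  cintegrable (fun x => f x + g x).
Proof.
move=> [f1 f2] [g1 g2]; split.
- by under eq_fun do rewrite re_add; exact: integrableD_EFin.
- by under eq_fun do rewrite im_add; exact: integrableD_EFin.
Qed.

Lemma cintegralD f g : cintegrable f -> cintegrable g ->
  cintegral D (fun x => f x + g x) = cintegral D f + cintegral D g.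
Proof.
move=> [f1 f2] [g1 g2]; apply: complex_ext; rewrite ?re_add ?im_add !(Re_cintegral, Im_cintegral).
- by under eq_Rintegral do rewrite re_add; rewrite RintegralD.
- by under eq_Rintegral do rewrite im_add; rewrite RintegralD.
Qed.

Lemma cintegrableZ z f : cintegrable f -> cintegrable (fun x => z * f x).
Proof.
move=> [f1 f2]; split.
- under eq_fun do rewrite re_mul -mulNr.
  by apply: integrableD_EFin => //; exact: integrableZ_EFin.
- under eq_fun do rewrite im_mul.
  by apply: integrableD_EFin => //; exact: integrableZ_EFin.
Qed.

Lemma cintegralZ z f : cintegrable f ->
  cintegral D (fun x => z * f x) = z * cintegral D f.
Proof.
move=> [f1 f2]; apply: complex_ext; rewrite ?re_mul ?im_mul !(Re_cintegral, Im_cintegral).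
- under eq_Rintegral do rewrite re_mul -mulNr.
  by rewrite RintegralD ?RintegralZl ?mulNr //; exact: integrableZ_EFin.
- under eq_Rintegral do rewrite im_mul.
  by rewrite RintegralD ?RintegralZl //; exact: integrableZ_EFin.
Qed.

Lemma cintegralJ f : cintegrable f ->
  cintegral D (fun x => conjc (f x)) = conjc (cintegral D f).
Proof.
move=> [f1 f2]; apply: complex_ext; rewrite ?re_conj ?im_conj !(Re_cintegral, Im_cintegral).
- by under eq_Rintegral do rewrite re_conj.
- by under eq_Rintegral do rewrite im_conj -mulN1r; rewrite RintegralZl // mulN1r.
Qed.

Lemma cintegrable0 : cintegrable (fun=> 0).
Proof. by split; exact: integrable0. Qed.

Lemma cintegral0 : cintegral D (fun=> 0) = 0.
Proof. by apply: complex_ext; rewrite !(Re_cintegral, Im_cintegral) /= Rintegral_cst ?mul0r. Qed.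

Lemma cintegrable_sum (I : Type) (s : seq I) (h : I -> R -> R[i]) :
  (forall i, cintegrable (h i)) -> cintegrable (fun x => \sum_(i <- s) h i x).
Proof.
move=> ih; elim: s => [|i s IH].
  by under eq_fun do rewrite big_nil; exact: cintegrable0.
by under eq_fun do rewrite big_cons; exact: cintegrableD.
Qed.

Lemma cintegral_sum (I : Type) (s : seq I) (h : I -> R -> R[i]) :
  (forall i, cintegrable (h i)) ->
  cintegral D (fun x => \sum_(i <- s) h i x) = \sum_(i <- s) cintegral D (h i).
Proof.
move=> ih; elim: s => [|i s IH].
  by rewrite big_nil; under eq_fun do rewrite big_nil; exact: cintegral0.
rewrite big_cons -IH -cintegralD //; last exact: cintegrable_sum.
by congr cintegral; apply/funext => x; rewrite big_cons.
Qed.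

Definition square_integrable f : Prop :=
  cmeasurable D (f : mR -> R[i]) /\ (sqnorm_integral D f < +oo)%E.

Definition sqnorm f : R := \int[lam]_(x in D) normc (f x) ^+ 2.

Lemma sqnorm_integral_ge0 f : (0 <= sqnorm_integral D f)%E.
Proof. by apply: integral_ge0 => x _; rewrite lee_fin sqr_ge0. Qed.

Lemma square_integrableP f : cmeasurable D (f : mR -> R[i]) ->
  square_integrable f <-> lam.-integrable D (EFin \o (fun x => normc (f x) ^+ 2)).
Proof.
move=> mf; have mn : measurable_fun D (EFin \o (fun x : mR => normc (f x) ^+ 2)).
  by apply/measurable_EFinP; exact: measurable_normc_sq.
have E : (\int[lam]_(x in D) `|(EFin \o (fun x => normc (f x) ^+ 2)%R) x| = sqnorm_integral D f)%E.
  by apply: eq_integral => x _ /=; rewrite ger0_norm // sqr_ge0.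
split=> [[_ h]|/integrableP[_]]; last by rewrite E.
by apply/integrableP; rewrite E.
Qed.

Lemma sqnormE f : square_integrable f -> sqnorm_integral D f = (sqnorm f)%:E.
Proof.
move=> [mf f2]; rewrite /sqnorm /Rintegral fineK // ge0_fin_numE //.
exact: sqnorm_integral_ge0.
Qed.

Lemma sqnorm_ge0 f : 0 <= sqnorm f.
Proof. by apply: Rintegral_ge0 => x _; rewrite sqr_ge0. Qed.

Lemma square_integrable_le f (h : R -> R) : cmeasurable D (f : mR -> R[i]) ->
  lam.-integrable D (EFin \o h) -> (forall x, D x -> normc (f x) ^+ 2 <= h x) ->
  square_integrable f.
Proof.
move=> mf ih fh; apply/square_integrableP => //.
apply: le_integrable ih => //.
  by apply/measurable_EFinP; exact: measurable_normc_sq.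
move=> x Dx /=; rewrite lee_fin ger0_norm ?sqr_ge0 // ger0_norm ?fh //.
by apply: le_trans (fh _ Dx); rewrite sqr_ge0.
Qed.

Lemma square_integrableD f g : square_integrable f -> square_integrable g ->
  square_integrable (fun x => f x + g x).
Proof.
move=> hf hg; have [mf _] := hf; have [mg _] := hg.
apply: (@square_integrable_le _ (fun x => 2 * normc (f x) ^+ 2 + 2 * normc (g x) ^+ 2)).
- exact: cmeasurableD.
- by apply: integrableD_EFin => //; apply: integrableZ_EFin => //; apply/square_integrableP.
- by move=> x _; exact: normc_sqD_le.
Qed.

Lemma square_integrable_bounded f g (M : R) :
  cmeasurable D (f : mR -> R[i]) -> square_integrable g ->
  (forall x, D x -> normc (f x) ^+ 2 <= M) -> square_integrable (fun x => f x * g x).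
Proof.
move=> mf hg fM; have [mg _] := hg.
apply: (@square_integrable_le _ (fun x => M * normc (g x) ^+ 2)).
- exact: cmeasurableM.
- by apply: integrableZ_EFin => //; apply/square_integrableP.
- by move=> x Dx; rewrite normc_sqM ler_wpM2r ?sqr_ge0 ?fM.
Qed.

Lemma square_integrableZ z f : square_integrable f -> square_integrable (fun x => z * f x).
Proof.
move=> hf; apply: (@square_integrable_bounded _ _ (normc z ^+ 2)) => //.
Qed.

Lemma square_integrableN f : square_integrable f -> square_integrable (fun x => - f x).
Proof. by move=> /(square_integrableZ (-1)); under eq_fun do rewrite mulN1r. Qed.

Lemma square_integrableB f g : square_integrable f -> square_integrable g ->
  square_integrable (fun x => f x - g x).
Proof. by move=> hf /square_integrableN; exact: square_integrableD. Qed.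

Lemma square_integrableJ f : square_integrable f -> square_integrable (fun x => conjc (f x)).
Proof.
move=> hf; have [mf _] := hf.
apply: (@square_integrable_le _ (fun x => normc (f x) ^+ 2)).
- exact: cmeasurableJ.
- exact/square_integrableP.
- by move=> x _; rewrite normc_sqJ.
Qed.

Lemma square_integrable_sum (I : Type) (s : seq I) (h : I -> R -> R[i]) :
  (forall i, square_integrable (h i)) -> square_integrable (fun x => \sum_(i <- s) h i x).
Proof.
move=> ih; elim: s => [|i s IH]; last first.
  by under eq_fun do rewrite big_cons; exact: square_integrableD.
under eq_fun do rewrite big_nil.
apply: (@square_integrable_le _ (cst 0)); first exact: cmeasurable_cst.
  exact: integrable0.
by move=> x _; rewrite ComplexField.Normc.normc0 expr0n.
Qed.

Lemma cintegrableM f g : square_integrable f -> square_integrable g ->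
  cintegrable (fun x => f x * g x).
Proof.
move=> hf hg; have [mf _] := hf; have [mg _] := hg.
have [m1 m2] := cmeasurableM mf mg.
have ih : lam.-integrable D
    (EFin \o (fun x => 1 * normc (f x) ^+ 2 + 1^-1 * normc (g x) ^+ 2)).
  by apply: integrableD_EFin => //; apply: integrableZ_EFin => //; apply/square_integrableP.
have h0 x : 0 <= 1 * normc (f x) ^+ 2 + 1^-1 * normc (g x) ^+ 2.
  by rewrite invr1 !mul1r addr_ge0 // sqr_ge0.
split; apply: le_integrable ih => //.
- exact/measurable_EFinP.
- by move=> x _ /=; rewrite lee_fin (ger0_norm (h0 x)) normr_ReM_le.
- exact/measurable_EFinP.
- by move=> x _ /=; rewrite lee_fin (ger0_norm (h0 x)) normr_ImM_le.
Qed.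

Lemma normr_Re_cintegralM_le (t : R) f g : 0 < t ->
  square_integrable f -> square_integrable g ->
  `|Rez (cintegral D (fun x => f x * g x))| <= t * sqnorm f + t^-1 * sqnorm g.
Proof.
move=> t0 hf hg; have [mf _] := hf; have [mg _] := hg.
have [i1 i2] := cintegrableM hf hg.
have if_ := (square_integrableP mf).1 hf; have ig_ := (square_integrableP mg).1 hg.
rewrite Re_cintegral; apply: le_trans (le_normr_Rintegral mD i1) _.
rewrite /sqnorm -!RintegralZl // -RintegralD; try exact: integrableZ_EFin; last by [].
apply: le_Rintegral => //.
- exact: (integrable_norm i1).
- by apply: integrableD_EFin => //; exact: integrableZ_EFin.
- by move=> x _; exact: normr_ReM_le.
Qed.

Lemma normr_Im_cintegralM_le (t : R) f g : 0 < t ->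
  square_integrable f -> square_integrable g ->
  `|Imz (cintegral D (fun x => f x * g x))| <= t * sqnorm f + t^-1 * sqnorm g.
Proof.
move=> t0 hf hg; have [mf _] := hf; have [mg _] := hg.
have [i1 i2] := cintegrableM hf hg.
have if_ := (square_integrableP mf).1 hf; have ig_ := (square_integrableP mg).1 hg.
rewrite Im_cintegral; apply: le_trans (le_normr_Rintegral mD i2) _.
rewrite /sqnorm -!RintegralZl // -RintegralD; try exact: integrableZ_EFin; last by [].
apply: le_Rintegral => //.
- exact: (integrable_norm i2).
- by apply: integrableD_EFin => //; exact: integrableZ_EFin.
- by move=> x _; exact: normr_ImM_le.
Qed.

Lemma sqnormB f g : square_integrable f -> square_integrable g ->
  sqnorm (fun x => f x - g x) =
  sqnorm f + (- 2) * Rez (cintegral D (fun x => f x * conjc (g x))) + sqnorm g.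
Proof.
move=> hf hg; have [mf _] := hf; have [mg _] := hg.
have [i1 i2] := cintegrableM hf (square_integrableJ hg).
have if_ := (square_integrableP mf).1 hf; have ig_ := (square_integrableP mg).1 hg.
rewrite Re_cintegral /sqnorm -RintegralZl // -!RintegralD //.
- by apply: eq_Rintegral => x _; rewrite normc_sqB.
- by apply: integrableD_EFin => //; exact: integrableZ_EFin.
- exact: integrableZ_EFin.
Qed.

(** Convergence of complex sequences is stated on real and imaginary parts, where
    the limit theorems of real integration apply. *)
Definition ccvg (u : nat -> R[i]) (z : R[i]) : Prop :=
  (Rez (u n) @[n --> \oo] --> Rez z) /\ (Imz (u n) @[n --> \oo] --> Imz z).

(** Norm convergence implies weak convergence. *)
Lemma ccvg_cintegralM (u : nat -> R -> R[i]) f g :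
  (forall n, square_integrable (u n)) -> square_integrable f -> square_integrable g ->
  (sqnorm_integral D (fun x => u n x - f x)%R @[n --> \oo] --> 0)%E ->
  ccvg (fun n => cintegral D (fun x => u n x * g x)) (cintegral D (fun x => f x * g x)).
Proof.
move=> hu hf hg uf.
have huf n := square_integrableB (hu n) hf.
have uf' : sqnorm (fun x => u n x - f x) @[n --> \oo] --> (0 : R).
  exact: (fine_cvg uf).
have E n : cintegral D (fun x => u n x * g x) =
    cintegral D (fun x => f x * g x) + cintegral D (fun x => (u n x - f x) * g x).
  rewrite -cintegralD; first (by apply: eq_cintegral => x _; ring);
    by apply: cintegrableM.
have G0 := sqnorm_ge0 g.
have key (e : R) : 0 < e -> \forall n \near \oo,
    `|Rez (cintegral D (fun x => (u n x - f x) * g x))| < e /\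
    `|Imz (cintegral D (fun x => (u n x - f x) * g x))| < e.
  (* With this weight the contribution of [g] stays below [e / 2]. *)
  move=> e0; pose t := 2 * (sqnorm g + 1) / e.
  have t0 : 0 < t by rewrite divr_gt0 //; lra.
  have s0 : 0 < e / (2 * t) by rewrite divr_gt0 //; lra.
  have : \forall n \near \oo, sqnorm (fun x => u n x - f x) < e / (2 * t).
    have /cvgr0Pnorm_lt /(_ _ s0) := uf'.
    by apply: filterS => n; apply: le_lt_trans; exact: ler_norm.
  apply: filterS => n hn.
  have b : t * sqnorm (fun x => u n x - f x) + t^-1 * sqnorm g < e.
    have -> : e = t * (e / (2 * t)) + t^-1 * (sqnorm g + 1).
      by rewrite /t; field; rewrite !gt_eqF //; lra.
    apply: ltrD; first by rewrite ltr_pM2l.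
    by rewrite ltr_pM2l ?invr_gt0 //; lra.
  split; apply: le_lt_trans b.
  - exact: normr_Re_cintegralM_le.
  - exact: normr_Im_cintegralM_le.
split; apply/cvgrPdist_lt => e e0; near=> n; rewrite E ?re_add ?im_add opprD addNKr normrN;
  by have [] : `|Rez (cintegral D (fun x => (u n x - f x) * g x))| < e /\
    `|Imz (cintegral D (fun x => (u n x - f x) * g x))| < e by near: n; exact: key.
Unshelve. all: by end_near. Qed.

End ComplexIntegral.

(** * Fourier series on the unit interval *)

Section FourierUniqueness.
Context {R : realType}.
Local Notation lam := (@lebesgue_measure R).
Local Notation mR := (measurableTypeR R).

Lemma integrable_cst_itv (b c r : R) :
  lam.-integrable (`[b, c[%classic : set mR) (EFin \o cst r).
Proof.
apply: measurable_bounded_integrable; [exact: measurable_itv| |exact: measurable_cst|].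
- by rewrite /= lebesgue_measure_itv /= lte_fin; case: ifPn; rewrite // -EFinB ltry.
- by exists `|r|; split; [exact: num_real|move=> y ry x _ /=; exact: ltW].
Qed.

(** The moments of orders [m] and [- m] separate the contributions of the real and
    imaginary parts of [h]. *)
Lemma fourier_uniqueness (b T : R) (h : R -> R[i]) : 0 < T ->
  cintegrable (`[b, b + T[ : set mR) h ->
  (forall m : int, cintegral (`[b, b + T[ : set mR)
     (fun x => h x * conjc (expi (2 * pi / T * m%:~R * x))) = 0) ->
  {ae lam, forall x, `[b, b + T[%classic x -> h x = 0}.
Proof.
move=> T0 [i1 i2] h0; set w := 2 * pi / T in h0.
set D := `[b, b + T[%classic : set mR in i1 i2 h0 *.
have mD : measurable D by exact: measurable_itv.
pose u x := Rez (h x); pose v x := Imz (h x).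
have icos (k : R -> R) c : lam.-integrable D (EFin \o k) ->
    lam.-integrable D (EFin \o (fun x => k x * cos (c * x))).
  move=> ik; have := integrable_mul_cos c 0 mD ik.
  by under eq_fun do rewrite addr0.
have isin (k : R -> R) c : lam.-integrable D (EFin \o k) ->
    lam.-integrable D (EFin \o (fun x => k x * sin (c * x))).
  move=> ik; have := integrable_mul_sin c 0 mD ik.
  by under eq_fun do rewrite addr0.
pose uc m := \int[lam]_(x in D) (u x * cos (w * m%:~R * x)).
pose us m := \int[lam]_(x in D) (u x * sin (w * m%:~R * x)).
pose vc m := \int[lam]_(x in D) (v x * cos (w * m%:~R * x)).
pose vs m := \int[lam]_(x in D) (v x * sin (w * m%:~R * x)).
have e1 m : uc m + vs m = 0.
  have := congr1 (@complex.Re R) (h0 m); rewrite Re_cintegral /= => <-.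
  rewrite /uc /vs -RintegralD //; [|exact: icos|exact: isin].
  by apply: eq_Rintegral => x _; rewrite re_mul /= /u /v; ring.
have e2 m : vc m - us m = 0.
  have := congr1 (@complex.Im R) (h0 m); rewrite Im_cintegral /= => <-.
  rewrite /vc /us -RintegralB //; [|exact: icos|exact: isin].
  by apply: eq_Rintegral => x _; rewrite im_mul /= /u /v; ring.
have even (k : R -> R) m : \int[lam]_(x in D) (k x * cos (w * (- m)%:~R * x)) =
    \int[lam]_(x in D) (k x * cos (w * m%:~R * x)).
  by apply: eq_Rintegral => x _; rewrite intrN mulrN mulNr cosN.
have odd (k : R -> R) m : lam.-integrable D (EFin \o k) ->
    \int[lam]_(x in D) (k x * sin (w * (- m)%:~R * x)) =
    - \int[lam]_(x in D) (k x * sin (w * m%:~R * x)).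
  move=> ik; rewrite -[RHS]mulN1r -RintegralZl //; last exact: isin.
  by apply: eq_Rintegral => x _; rewrite intrN mulrN mulNr sinN; ring.
have uc0 m : uc m = 0.
  by have := e1 m; have := e1 (- m); rewrite /uc /vs even odd //; lra.
have vs0 m : vs m = 0 by have := e1 m; rewrite uc0 add0r.
have vc0 m : vc m = 0.
  by have := e2 m; have := e2 (- m); rewrite /vc /us even odd //; lra.
have us0 m : us m = 0 by have := e2 m; rewrite vc0 sub0r => /eqP; rewrite oppr_eq0 => /eqP.
have orth (k : R -> R) : lam.-integrable D (EFin \o k) ->
    (forall m : int, \int[lam]_(x in D) (k x * cos (w * m%:~R * x)) = 0) ->
    (forall m : int, \int[lam]_(x in D) (k x * sin (w * m%:~R * x)) = 0) ->
    trig_orthogonal w D k.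
  move=> ik c0 s0; split => // m d.
  transitivity (\int[lam]_(x in D) (cos d * (k x * cos (w * m%:~R * x)) +
      (- sin d) * (k x * sin (w * m%:~R * x)))).
    by apply: eq_Rintegral => x _; rewrite cosD; ring.
  rewrite RintegralD // ?RintegralZl //.
  - by rewrite c0 s0 !mulr0 addr0.
  - exact: isin.
  - exact: icos.
  - by apply: integrableZ_EFin => //; exact: icos.
  - by apply: integrableZ_EFin => //; exact: isin.
have zu := trig_orthogonal_eq0 T0 (orth u i1 uc0 us0).
have zv := trig_orthogonal_eq0 T0 (orth v i2 vc0 vs0).
apply: ae_mono (ae_and zu zv) => x [hu hv] Dx.
by apply: complex_ext; [exact: hu|exact: hv].
Qed.

End FourierUniqueness.

Section FourierSums.
Context {R : realType}.
Local Notation lam := (@lebesgue_measure R).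
Local Notation mR := (measurableTypeR R).
Local Notation U := (`[0, 1[%classic : set mR).
Implicit Types (l m : int) (c : int -> R[i]) (F G : R -> R[i]).

Definition char l (xi : R) : R[i] := expi (- (2 * pi * l%:~R * xi)).

Definition coef G l : R[i] := cintegral U (fun xi => G xi * conjc (char l xi)).

Definition fourier_sum c N (xi : R) : R[i] :=
  \sum_(k < (2 * N).+1) c (k%:Z - N%:Z) * char (k%:Z - N%:Z) xi.

(** The squared norm of the Fourier sum, see [sqnorm_fourier_sum]. *)
Definition energy c N : R := \sum_(k < (2 * N).+1) normc (c (k%:Z - N%:Z)) ^+ 2.

Let mU : measurable U. Proof. exact: measurable_itv. Qed.

Lemma charD l m xi : char (l + m) xi = char l xi * char m xi.
Proof. by rewrite /char -expiD intrD; congr expi; ring. Qed.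

Lemma charN l xi : char (- l) xi = conjc (char l xi).
Proof. by rewrite /char -expiN intrN; congr expi; ring. Qed.

Lemma char0 xi : char 0 xi = 1.
Proof. by rewrite /char mulr0 mul0r oppr0 expi0. Qed.

Lemma expi_int l : expi (2 * pi * l%:~R) = 1 :> R[i].
Proof.
have e1 : expi (2 * pi) = 1 :> R[i].
  by rewrite mulrC mulr_natr /expi cos2pi sin2pi.
have en (n : nat) : expi (2 * pi * n%:R) = 1 :> R[i].
  elim: n => [|n IH]; first by rewrite mulr0 expi0.
  by rewrite -[n.+1%:R]natr1 mulrDr mulr1 expiD IH e1 mulr1.
case: l => n; first exact: en.
by rewrite NegzE intrN mulrN expiN en conjc1.
Qed.

Lemma char_periodic l xi : char l (xi + 1) = char l xi.
Proof.
rewrite /char (_ : - (2 * pi * l%:~R * (xi + 1)) =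
  - (2 * pi * l%:~R * xi) + 2 * pi * (- l)%:~R); last by rewrite intrN; ring.
by rewrite expiD expi_int mulr1.
Qed.

Lemma fourier_sum_periodic c N xi : fourier_sum c N (xi + 1) = fourier_sum c N xi.
Proof. by apply: eq_bigr => k _; rewrite char_periodic. Qed.

Lemma char_square_integrableM l G : square_integrable U G ->
  square_integrable U (fun xi => G xi * char l xi).
Proof.
move=> hG.
have -> : (fun xi => G xi * char l xi) = (fun xi => char l xi * G xi).
  by apply/funext => xi; rewrite mulrC.
apply: (@square_integrable_bounded _ _ mU _ _ 1) => //; last first.
  by move=> x _; rewrite normc_expi.
apply: cmeasurable_expi; apply: measurable_funN.
by apply: measurable_funM => //; exact: measurable_cst.
Qed.

Lemma square_integrable_cst z : square_integrable U (fun=> z).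
Proof.
split; first exact: cmeasurable_cst.
rewrite /sqnorm_integral integral_cst //= lebesgue_measure_itv /= lte_fin ltr01.
by rewrite sube0 mule1 ltry.
Qed.

Lemma char_square_integrable l : square_integrable U (char l).
Proof.
have := char_square_integrableM l (square_integrable_cst 1).
by rewrite (_ : (fun xi => 1 * char l xi) = char l) //; apply/funext => xi; rewrite mul1r.
Qed.

Lemma fourier_sum_square_integrable c N : square_integrable U (fourier_sum c N).
Proof.
apply: (square_integrable_sum mU) => k; apply: (square_integrableZ mU).
exact: char_square_integrable.
Qed.

Lemma integral_cos_affine (w d : R) : w != 0 -> sin (w + d) = sin d ->
  \int[lam]_(x in U) cos (w * x + d) = 0.
Proof.
move=> w0 swd.
pose F x := w^-1 * sin (w * x + d).
have dF x : is_derive (x : R) 1 F (cos (w * x + d)).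
  have dl : is_derive (x : R) (1 : R) ((w \*: (@id R)) + (@cst R R d)) w.
    by apply: is_derive_eq; rewrite /GRing.scale /= mulr1 addr0.
  have dsl : is_derive (x : R) (1 : R) (sin \o ((w \*: (@id R)) + (@cst R R d)))
      (cos (w * x + d) * w) by exact: is_derive1_comp.
  have := @is_deriveZ R R R _ w^-1 x 1 _ dsl.
  by rewrite (_ : w^-1 *: (cos (w * x + d) * w) = cos (w * x + d)) // /GRing.scale /=; field.
have cF : continuous F.
  by move=> x; apply/differentiable_continuous/derivable1_diffP.
have cc : continuous (fun x : R => cos (w * x + d)).
  move=> x; apply: continuous_comp; last exact: continuous_cos.
  by apply: cvgD; [apply: cvgM; [exact: cvg_cst|exact: cvg_id]|exact: cvg_cst].
rewrite Rintegral_itv_bndo_bndc //; last first.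
  have := @integrable_mul_cos R U (cst 1) w d mU.
  rewrite (_ : (fun x => cst 1 x * cos (w * x + d)) = (fun x => cos (w * x + d))); last first.
    by apply/funext => x; rewrite mul1r.
  by apply; exact: integrable_cst_itv.
rewrite /Rintegral (@continuous_FTC2 _ _ F) //.
- by rewrite /F mulr1 mulr0 add0r swd -EFinB subrr.
- exact: continuous_subspaceT.
- split.
  + by move=> x _; exact: ex_derive.
  + by apply: cvg_at_right_filter; exact: cF.
  + by apply: cvg_at_left_filter; exact: cF.
- by move=> x _; rewrite derive1E; exact: derive_val.
Qed.

Lemma fine_lebesgue_unit : fine (lam U) = 1.
Proof. by rewrite lebesgue_measure_itv /= lte_fin ltr01 /= oppr0 addr0. Qed.

Lemma cintegral_char l : cintegral U (char l) = (l == 0)%:R.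
Proof.
have [->|l0] := eqVneq l 0.
  apply: complex_ext; rewrite !(Re_cintegral, Im_cintegral);
    under eq_Rintegral do rewrite char0; rewrite Rintegral_cst //= fine_lebesgue_unit mulr1 //.
have w0 : - (2 * pi * l%:~R) != 0 :> R.
  by rewrite oppr_eq0 !mulf_neq0 ?intr_eq0 // gt_eqF // pi_gt0.
have per d : sin (- (2 * pi * l%:~R) + d) = sin d :> R.
  have := congr1 (@complex.Im R) (expiD (2 * pi * (- l)%:~R) d).
  by rewrite expi_int mul1r /= intrN mulrN.
apply: complex_ext; rewrite !(Re_cintegral, Im_cintegral) /char /=.
  rewrite -[RHS](integral_cos_affine w0 (per 0)).
  by apply: eq_Rintegral => x _; rewrite addr0 mulNr.
rewrite -[RHS](integral_cos_affine w0 (per (- (pi / 2)))).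
by apply: eq_Rintegral => x _; rewrite -mulNr cosB cos_pihalf sin_pihalf mulr0 add0r mulr1.
Qed.

Lemma coef_char m l : coef (char m) l = (m == l)%:R.
Proof.
rewrite -subr_eq0 -cintegral_char /coef; apply: eq_cintegral => x _.
by rewrite charD charN.
Qed.

Lemma cintegrable_coef G l : square_integrable U G ->
  cintegrable U (fun xi => G xi * conjc (char l xi)).
Proof.
by move=> hG; apply: cintegrableM => //; apply: square_integrableJ => //;
  exact: char_square_integrable.
Qed.

Lemma coef_fourier_sum c N l : (- N%:Z <= l <= N%:Z) ->
  coef (fourier_sum c N) l = c l.
Proof.
move=> lN; rewrite /coef.
transitivity (cintegral U (fun xi => \sum_(k < (2 * N).+1)
    c (k%:Z - N%:Z) * (char (k%:Z - N%:Z) xi * conjc (char l xi)))).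
  by apply: eq_cintegral => x _; rewrite mulr_suml; apply: eq_bigr => k _; rewrite mulrA.
rewrite cintegral_sum //; last first.
  move=> k; apply: cintegrableZ => //; apply: cintegrable_coef.
  exact: char_square_integrable.
have kl : (absz (l + N%:Z)%R < (2 * N).+1)%N by lia.
rewrite (bigD1 (Ordinal kl)) //= big1 ?addr0.
  rewrite cintegralZ //; last by apply: cintegrable_coef; exact: char_square_integrable.
  have -> : Posz (absz (l + N%:Z)%R) - N%:Z = l by lia.
  by have := coef_char l l; rewrite /coef eqxx => ->; rewrite mulr1.
move=> k kne; rewrite cintegralZ //; last by apply: cintegrable_coef; exact: char_square_integrable.
have := coef_char (k%:Z - N%:Z) l; rewrite /coef => ->.
case: eqP => [e|_]; last by rewrite mulr0.
by move/eqP: kne; case; apply: val_inj => /=; lia.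
Qed.

Lemma cintegral_conj_fourier_sum G c N : square_integrable U G ->
  cintegral U (fun xi => G xi * conjc (fourier_sum c N xi)) =
  \sum_(k < (2 * N).+1) conjc (c (k%:Z - N%:Z)) * coef G (k%:Z - N%:Z).
Proof.
move=> hG.
transitivity (cintegral U (fun xi => \sum_(k < (2 * N).+1)
    conjc (c (k%:Z - N%:Z)) * (G xi * conjc (char (k%:Z - N%:Z) xi)))).
  apply: eq_cintegral => x _; rewrite /fourier_sum conj_sum mulr_sumr.
  by apply: eq_bigr => k _; rewrite conj_mul mulrCA.
rewrite cintegral_sum //; last by move=> k; apply: cintegrableZ => //; exact: cintegrable_coef.
by apply: eq_bigr => k _; rewrite cintegralZ //; exact: cintegrable_coef.
Qed.

Lemma re_conj_mul (z : R[i]) : Rez (conjc z * z) = normc z ^+ 2.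
Proof. by rewrite normc_sqE re_mul re_conj im_conj; ring. Qed.

Lemma sqnormE_cintegral G : sqnorm U G = Rez (cintegral U (fun xi => G xi * conjc (G xi))).
Proof.
rewrite Re_cintegral; apply: eq_Rintegral => x _.
by rewrite mulrC re_conj_mul.
Qed.

Lemma sqnorm_fourier_sum c N : sqnorm U (fourier_sum c N) = energy c N.
Proof.
rewrite sqnormE_cintegral cintegral_conj_fourier_sum; last exact: fourier_sum_square_integrable.
rewrite Re_sum; apply: eq_bigr => k _; rewrite coef_fourier_sum ?re_conj_mul //.
have := ltn_ord k; lia.
Qed.

Lemma energy_ge0 c N : 0 <= energy c N.
Proof. by apply: sumr_ge0 => k _; rewrite sqr_ge0. Qed.

(** Pythagoras' theorem: the difference is orthogonal to the Fourier sum. *)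
Lemma sqnorm_sub_fourier_sum G N c : square_integrable U G ->
  (forall l : int, - N%:Z <= l <= N%:Z -> coef G l = c l) ->
  sqnorm U (fun xi => G xi - fourier_sum c N xi) = sqnorm U G - energy c N.
Proof.
move=> hG Gc; rewrite sqnormB //; last exact: fourier_sum_square_integrable.
rewrite sqnorm_fourier_sum cintegral_conj_fourier_sum // Re_sum.
rewrite (_ : \sum_(_ < _) _ = energy c N); first by ring.
apply: eq_bigr => k _; rewrite Gc ?re_conj_mul //.
have := ltn_ord k; lia.
Qed.

Lemma bessel G N : square_integrable U G -> energy (coef G) N <= sqnorm U G.
Proof.
move=> hG; rewrite -subr_ge0 -sqnorm_sub_fourier_sum //; exact: sqnorm_ge0.
Qed.

Lemma sqnorm_sub_fourier_sums c N M : (N <= M)%N ->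
  sqnorm U (fun xi => fourier_sum c M xi - fourier_sum c N xi) = energy c M - energy c N.
Proof.
move=> NM; rewrite sqnorm_sub_fourier_sum ?sqnorm_fourier_sum //.
  exact: fourier_sum_square_integrable.
by move=> l lN; apply: coef_fourier_sum; lia.
Qed.

Lemma le_energy c N M : (N <= M)%N -> energy c N <= energy c M.
Proof. by move=> NM; rewrite -subr_ge0 -sqnorm_sub_fourier_sums //; exact: sqnorm_ge0. Qed.

Lemma cintegrable_square_integrable G : square_integrable U G -> cintegrable U G.
Proof.
move=> hG; have := cintegrable_coef 0 hG.
rewrite (_ : (fun xi => G xi * conjc (char 0 xi)) = G) //.
by apply/funext => xi; rewrite char0 conjc1 mulr1.
Qed.

Lemma coef_sub F G l : square_integrable U F -> square_integrable U G ->
  coef (fun xi => F xi - G xi) l = coef F l - coef G l.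
Proof.
move=> hF hG; have iF := cintegrable_coef l hF; have iG := cintegrable_coef l hG.
rewrite /coef -[X in _ = _ - X]mul1r -mulNr -cintegralZ // -cintegralD //; last exact: cintegrableZ.
by apply: eq_cintegral => x _; ring.
Qed.

Definition fourier_series c F : Prop :=
  cmeasurable U (F : mR -> R[i]) /\
  (fun N => sqnorm_integral U (fun xi => fourier_sum c N xi - F xi)) @ \oo --> 0%E.

Lemma fourier_series_square_integrable c F : fourier_series c F -> square_integrable U F.
Proof.
move=> [mF cF].
have [N hN] : exists N, (sqnorm_integral U (fun xi => fourier_sum c N xi - F xi)%R < +oo)%E.
  have /fine_cvgP[[N _ /(_ N (leqnn N)) fN] _] := cF.
  by exists N; rewrite ltey_eq fN.
have hB : square_integrable U (fun xi => fourier_sum c N xi - F xi).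
  split=> //; apply: cmeasurableB => //; exact: (fourier_sum_square_integrable c N).1.
have := square_integrableB mU (fourier_sum_square_integrable c N) hB.
rewrite (_ : (fun xi => _ - (_ - _)) = F) //.
by apply/funext => x; ring.
Qed.

Lemma fourier_series_pairing c F G : fourier_series c F -> square_integrable U G ->
  ccvg (fun N => \sum_(k < (2 * N).+1) c (k%:Z - N%:Z) * conjc (coef G (k%:Z - N%:Z)))
    (cintegral U (fun xi => F xi * conjc (G xi))).
Proof.
move=> hF hG; have F2 := fourier_series_square_integrable hF.
have := ccvg_cintegralM mU (fun N => fourier_sum_square_integrable c N) F2
  (square_integrableJ mU hG) hF.2.
rewrite (_ : (fun N => cintegral U _) = (fun N => \sum_(k < (2 * N).+1)
  c (k%:Z - N%:Z) * conjc (coef G (k%:Z - N%:Z)))) //.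
apply/funext => N; rewrite -[LHS]conjcK -[RHS]conjcK; congr conjc.
rewrite -cintegralJ //; last first.
  apply: cintegrableM => //; last exact: square_integrableJ.
  exact: fourier_sum_square_integrable.
transitivity (cintegral U (fun xi => G xi * conjc (fourier_sum c N xi))).
  by apply: eq_cintegral => x _; rewrite conj_mul conjcK mulrC.
rewrite cintegral_conj_fourier_sum // conj_sum.
by apply: eq_bigr => k _; rewrite conj_mul conjcK.
Qed.

Lemma coef_mul_conj_char G j l : coef (fun xi => G xi * conjc (char j xi)) l = coef G (l + j).
Proof. by apply: eq_cintegral => x _; rewrite charD conj_mul -mulrA [X in _ * X]mulrC. Qed.

(** Parseval's identity for [F] and the product of [G] with a character. *)
Lemma fourier_series_pairing_shift c F G j : fourier_series c F -> square_integrable U G ->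
  ccvg (fun N => \sum_(k < (2 * N).+1) c (k%:Z - N%:Z) * conjc (coef G (k%:Z - N%:Z + j)))
    (coef (fun xi => F xi * conjc (G xi)) (- j)).
Proof.
move=> hF hG.
have hG' : square_integrable U (fun xi => G xi * conjc (char j xi)).
  rewrite (_ : (fun xi => G xi * _) = (fun xi => G xi * char (- j) xi)).
    exact: char_square_integrableM.
  by apply/funext => xi; rewrite charN.
have := fourier_series_pairing hF hG'.
rewrite (_ : (fun N => \sum_(k < _) _) = (fun N => \sum_(k < (2 * N).+1)
   c (k%:Z - N%:Z) * conjc (coef G (k%:Z - N%:Z + j)))); last first.
  by apply/funext => N; apply: eq_bigr => k _; rewrite coef_mul_conj_char.
rewrite (_ : cintegral U _ = coef (fun xi => F xi * conjc (G xi)) (- j)) //.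
by apply: eq_cintegral => x _; rewrite charN conj_mul mulrA.
Qed.

Lemma ccvg_unique (u : nat -> R[i]) z w : ccvg u z -> ccvg u w -> z = w.
Proof.
move=> [z1 z2] [w1 w2].
by apply: complex_ext;
  [exact: (cvg_unique (@Rhausdorff R) z1 w1)|exact: (cvg_unique (@Rhausdorff R) z2 w2)].
Qed.

(** A Fourier coefficient is weakly continuous, and that of the Fourier sums is
    eventually constant. *)
Lemma coef_fourier_series c F l : fourier_series c F -> coef F l = c l.
Proof.
move=> hF; have F2 := fourier_series_square_integrable hF.
have hl := square_integrableJ mU (char_square_integrable l).
have [h1 h2] := ccvg_cintegralM mU (fun N => fourier_sum_square_integrable c N) F2 hl hF.2.
have E : \forall N \near \oo,
    cintegral U (fun xi => fourier_sum c N xi * conjc (char l xi)) = c l.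
  by exists `|l|%N => // N /= lN; apply: coef_fourier_sum; lia.
apply/esym; apply: (@ccvg_unique (fun=> c l)); first by split; exact: cvg_cst.
split.
- by apply: cvg_trans h1; apply: near_eq_cvg; apply: filterS E => N ->.
- by apply: cvg_trans h2; apply: near_eq_cvg; apply: filterS E => N ->.
Qed.

Lemma coef_eq0 (h : R -> R[i]) : cintegrable U h -> (forall l, coef h l = 0) ->
  {ae lam, forall xi, U xi -> h xi = 0}.
Proof.
move=> ih h0.
have E : U = `[0, 0 + 1[%classic by rewrite add0r.
rewrite E; apply: (@fourier_uniqueness _ 0 1 h) => //; rewrite -E //.
move=> m; rewrite -[RHS](h0 (- m)); apply: eq_cintegral => x _.
by rewrite /char intrN divr1; congr (_ * conjc (expi _)); ring.
Qed.

End FourierSums.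

(** * The Riesz-Fischer theorem *)

Section AlmostEverywhereBounds.
Context d (T : measurableType d) {R : realType} (mu : {measure set T -> \bar R}).

Variables (D : set T) (mD : measurable D) (g : nat -> T -> R) (C : R).
Hypothesis mg : forall n, measurable_fun D (g n).
Hypothesis g0 : forall n x, D x -> 0 <= g n x.
Hypothesis ndg : forall x, D x -> {homo g ^~ x : n m / (n <= m)%N >-> n <= m}.
Hypothesis gC : forall n, (\int[mu]_(x in D) (g n x)%:E <= C%:E)%E.

Let e n x := (g n x)%:E.

Let nde x : D x -> {homo e ^~ x : n m / (n <= m)%N >-> (n <= m)%E}.
Proof. by move=> Dx n m nm; rewrite lee_fin ndg. Qed.

Let ce x : D x -> cvgn (e ^~ x).
Proof. by move=> Dx; exact: ereal_nondecreasing_is_cvgn (nde Dx). Qed.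

Lemma le_limn_nondecreasing n x : D x -> ((g n x)%:E <= limn (fun n => (g n x)%:E))%E.
Proof.
move=> Dx; apply: lime_ge; first exact: ce.
by exists n => // m /= nm; exact: nde.
Qed.

Lemma integrable_limn_nondecreasing :
  mu.-integrable D (fun x => limn (fun n => (g n x)%:E)).
Proof.
have me n : measurable_fun D (e n) by apply/measurable_EFinP; exact: mg.
have e0 n x : D x -> (0 <= e n x)%E by move=> Dx; rewrite lee_fin g0.
pose h x := limn (e ^~ x).
have mh : measurable_fun D h.
  by apply: (emeasurable_fun_cvg e) => // x Dx; exact: ce.
have h0 x : D x -> (0 <= h x)%E.
  by move=> Dx; apply: lime_ge; [exact: ce|apply: nearW => n; exact: e0].
have hC : (\int[mu]_(x in D) h x <= C%:E)%E.
  have c := cvg_monotone_convergence (mu := mu) mD me e0 nde.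
  rewrite -(cvg_lim _ c) //; apply: lime_le; first by apply/cvg_ex; eexists; exact: c.
  by apply: nearW => n; exact: gC.
apply/integrableP; split=> //; apply: le_lt_trans (ltry C).
apply: le_trans hC; apply: ge0_le_integral => //.
- by apply: measurableT_comp mh.
- by move=> x Dx; rewrite gee0_abs // h0.
Qed.

(** The limit is integrable by monotone convergence, hence finite almost
    everywhere. *)
Lemma ae_bounded_of_integral :
  {ae mu, forall x, D x -> exists M, forall n, g n x <= M}.
Proof.
apply: ae_mono (integrable_ae mD integrable_limn_nondecreasing) => x fh Dx.
exists (fine (limn (fun n => (g n x)%:E))) => n.
by rewrite -lee_fin fineK ?fh // le_limn_nondecreasing.
Qed.

End AlmostEverywhereBounds.

Section LimInf.
Context {R : realType}.

Lemma limn_einf_le (u : nat -> \bar R) (l : \bar R) :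
  (forall n, u n <= l)%E -> (limn_einf u <= l)%E.
Proof.
move=> ul; rewrite limn_einf_lim; apply: lime_le; first exact: is_cvg_einfs.
apply: nearW => n; apply: le_trans (ul n).
by apply: ereal_inf_lbound; exists n => /=.
Qed.

Lemma limn_einf_ge (u : nat -> \bar R) (l : \bar R) :
  (forall n, l <= u n)%E -> (l <= limn_einf u)%E.
Proof.
move=> lu; rewrite limn_einf_lim; apply: lime_ge; first exact: is_cvg_einfs.
by apply: nearW => n; apply: le_ereal_inf_tmp => _ [k _ <-].
Qed.

End LimInf.

Section RieszFischer.
Context {R : realType}.
Local Notation lam := (@lebesgue_measure R).
Local Notation mR := (measurableTypeR R).
Local Notation U := (`[0, 1[%classic : set mR).

Let mU : measurable U. Proof. exact: measurable_itv. Qed.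

Lemma cvgn_of_bounded_variation (u : nat -> R) (M : R) :
  (forall n, \sum_(0 <= k < n) `|u k.+1 - u k| <= M) -> cvgn u.
Proof.
move=> hM.
have : cvgn [normed series (telescope u)].
  apply: nondecreasing_is_cvgn.
    apply/nondecreasing_seqP => n.
    rewrite /normed_series_of /series /= [leRHS]big_nat_recr //= lerDl.
    exact: normr_ge0.
  by exists M => _ [n _ <-]; exact: hM.
move=> /normed_cvg; rewrite telescopeK => c.
rewrite (_ : u = (fun n => u n - u 0%N) + cst (u 0%N)); last first.
  by apply/funext => n; rewrite /= subrK.
by apply: is_cvgD => //; exact: is_cvg_cst.
Qed.

Lemma sum_half_exp_le2 (n : nat) : \sum_(0 <= k < n) (2^-1) ^+ k <= 2 :> R.
Proof.
suff -> : \sum_(0 <= k < n) (2^-1) ^+ k = 2 - 2 * (2^-1) ^+ n :> R.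
  by rewrite gerBl mulr_ge0 // exprn_ge0.
elim: n => [|n IH]; first by rewrite big_geq // expr0; lra.
by rewrite big_nat_recr //= IH exprS; field.
Qed.

(** The hypothesis says that the tail of the coefficients beyond [n_ k] has squared
    norm at most [4 ^ (- k)]. *)
Variables (c : int -> R[i]) (n_ : nat -> nat).
Hypothesis hn : forall k M, energy c M <= energy c (n_ k) + (4^-1) ^+ k.

Let S := fourier_sum c.

Let sqS p q : sqnorm U (fun xi => S p xi - S q xi) = `|energy c p - energy c q|.
Proof.
have [qp|pq] := leqP q p.
  by rewrite sqnorm_sub_fourier_sums // ger0_norm // subr_ge0 le_energy.
rewrite distrC ger0_norm ?subr_ge0 ?le_energy ?(ltnW pq) //.
rewrite -sqnorm_sub_fourier_sums ?(ltnW pq) //; apply: eq_Rintegral => x _.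
by rewrite -[_ - S q x]opprB -mulN1r normc_sqM (_ : normc (-1) ^+ 2 = 1) ?mul1r //
   normc_sqE /= oppr0 sqrrN expr1n expr0n addr0.
Qed.

Let hE j k p : (j <= k)%N -> (n_ j <= p)%N -> `|energy c (n_ k) - energy c p| <= (4^-1) ^+ j.
Proof.
move=> jk jp; rewrite ler_norml; apply/andP; split.
  have := hn k p; have : (4^-1 : R) ^+ k <= (4^-1) ^+ j.
    by apply: ler_wiXn2l => //; lra.
  by lra.
by have := hn j (n_ k); have := le_energy c jp; lra.
Qed.

Let S2 p q : square_integrable U (fun xi => S p xi - S q xi).
Proof. by apply: square_integrableB => //; exact: fourier_sum_square_integrable. Qed.

(** Along [n_] the [k]-th increment of the Fourier sums has squared norm at most
    [4 ^ (- k)], so the series of the squared increments weighted by [2 ^ k] is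
    integrable. It controls the variation of the sequence at a point, since
    [x <= 2 ^ k * x ^ 2 + 2 ^ (- k)]. *)
Lemma ae_ccvg_fourier_sum : {ae lam, forall xi, U xi ->
  exists z, ccvg (fun k => S (n_ k) xi) z}.
Proof.
pose D k xi := S (n_ k.+1) xi - S (n_ k) xi.
pose g n xi := \sum_(0 <= k < n) 2 ^+ k * normc (D k xi) ^+ 2.
have mD k : measurable_fun U (fun xi : mR => normc (D k xi) ^+ 2 : mR).
  by apply: measurable_normc_sq; exact: (S2 _ _).1.
have iD k : (\int[lam]_(xi in U) (2 ^+ k * normc (D k xi) ^+ 2)%:E <= ((2^-1) ^+ k)%:E)%E.
  under eq_integral do rewrite EFinM.
  rewrite ge0_integralZl_EFin //; last 2 first.
  - by move=> x _; rewrite lee_fin sqr_ge0.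
  - by apply/measurable_EFinP; exact: mD.
  have -> : (\int[lam]_(xi in U) (normc (D k xi) ^+ 2)%:E =
     (sqnorm U (fun xi => S (n_ k.+1) xi - S (n_ k) xi))%:E)%E.
    by rewrite -sqnormE.
  rewrite -EFinM lee_fin sqS.
  have -> : (2^-1 : R) ^+ k = 2 ^+ k * (4^-1) ^+ k by rewrite -exprMn; congr (_ ^+ k); field.
  by rewrite ler_wpM2l ?exprn_ge0 // hE.
have gint n : (\int[lam]_(xi in U) (g n xi)%:E <= 2%:E)%E.
  under eq_integral do rewrite /g -sumEFin.
  rewrite ge0_integral_sum //; last 2 first.
  - move=> k; apply/measurable_EFinP; apply: measurable_funM => //; exact: mD.
  - by move=> k x _; rewrite lee_fin mulr_ge0 ?sqr_ge0 ?exprn_ge0.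
  apply: le_trans (_ : (\sum_(0 <= k < n) ((2^-1) ^+ k)%:E <= _)%E).
    by apply: lee_sum => k _; exact: iD.
  by rewrite sumEFin lee_fin sum_half_exp_le2.
have t0 k xi : 0 <= 2 ^+ k * normc (D k xi) ^+ 2.
  by rewrite mulr_ge0 ?sqr_ge0 ?exprn_ge0.
have H := @ae_bounded_of_integral _ _ _ lam U mU g 2 _ _ _ gint.
apply: ae_mono (H _ _ _).
- move=> xi hM Uxi; have [M gM] := hM Uxi.
  have bd (w : R[i] -> R) : (forall z, `|w z| ^+ 2 <= normc z ^+ 2) ->
      (forall z z', w (z - z') = w z - w z') -> cvgn (fun k => w (S (n_ k) xi)).
    move=> w2 wB; apply: (@cvgn_of_bounded_variation _ (M + 2)) => n.
    apply: (le_trans (_ : _ <= g n xi + \sum_(0 <= k < n) (2^-1) ^+ k)); last first.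
      by apply: lerD; [exact: gM|exact: sum_half_exp_le2].
    rewrite -big_split /=; apply: ler_sum => k _; rewrite -wB.
    have := w2 (D k xi); rewrite -/(D k xi); set x := `|_|; set y := normc _ ^+ 2 => xy.
    have p0 : (0 : R) < 2 ^+ k by rewrite exprn_gt0.
    rewrite exprVn; set p := 2 ^+ k in p0 *.
    have x0 : 0 <= x by exact: normr_ge0.
    have : 0 <= p * (x - p^-1) ^+ 2 by rewrite mulr_ge0 ?sqr_ge0 ?ltW.
    have -> : p * (x - p^-1) ^+ 2 = p * x ^+ 2 - 2 * x + p^-1 by field; rewrite gt_eqF.
    have : p * x ^+ 2 <= p * y by rewrite ler_pM2l.
    by lra.
  have c1 : cvgn (fun k => Rez (S (n_ k) xi)).
    apply: bd => [z|z z']; last by rewrite re_add re_opp.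
    by rewrite real_normK ?num_real // normc_sqE lerDl sqr_ge0.
  have c2 : cvgn (fun k => Imz (S (n_ k) xi)).
    apply: bd => [z|z z']; last by rewrite im_add im_opp.
    by rewrite real_normK ?num_real // normc_sqE lerDr sqr_ge0.
  by exists (limn (fun k => Rez (S (n_ k) xi)) +i* limn (fun k => Imz (S (n_ k) xi))).
- by move=> n; apply: measurable_sum => k; apply: measurable_funM => //; exact: mD.
- by move=> n xi _; apply: sumr_ge0 => k _; exact: t0.
- move=> xi _; apply/nondecreasing_seqP => n.
  by rewrite /g big_nat_recr //= lerDl t0.
Qed.

(** By Fatou's lemma the pointwise limit along [n_] is the limit of the whole
    sequence of Fourier sums in quadratic mean. *)
Lemma fourier_series_of_ccvg (F : R -> R[i]) : cmeasurable U (F : mR -> R[i]) ->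
  {ae lam, forall xi, U xi -> ccvg (fun k => S (n_ k) xi) (F xi)} ->
  fourier_series c F.
Proof.
move=> mF cF; split=> //.
have bnd j N : (n_ j <= N)%N ->
    (sqnorm_integral U (fun xi => S N xi - F xi)%R <= ((4^-1) ^+ j)%:E)%E.
  move=> jN.
  pose f k xi := (normc (S (n_ (j + k)) xi - S N xi) ^+ 2)%:E.
  have f0 k xi : (0 <= f k xi)%E by rewrite lee_fin sqr_ge0.
  have mf k : measurable_fun U (f k : mR -> \bar R).
    by apply/measurable_EFinP; apply: measurable_normc_sq; exact: (S2 _ _).1.
  have mS : cmeasurable U (S N : mR -> R[i]) := (fourier_sum_square_integrable c N).1.
  have -> : sqnorm_integral U (fun xi => S N xi - F xi) =
     (\int[lam]_(xi in U) limn_einf (f ^~ xi))%E.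
    apply: ge0_ae_eq_integral => //.
    - by apply/measurable_EFinP/measurable_normc_sq; exact: cmeasurableB.
    - rewrite (_ : (fun xi => limn_einf (f ^~ xi)) =
          (fun xi => - limn_esup (fun k => - f k xi))%E); last first.
        by apply/funext => xi; rewrite -limn_einfN; congr limn_einf;
          apply/funext => k; rewrite [RHS]oppeK.
      apply: measurableT_comp => //.
      by apply: measurable_fun_limn_esup => k; apply: measurableT_comp (mf k).
    - by move=> xi _; rewrite lee_fin sqr_ge0.
    - by move=> xi _; apply: limn_einf_ge.
    - apply: ae_mono cF => xi + Uxi => /(_ Uxi)[h1 h2].
      have s1 : Rez (S (n_ (j + k)) xi) @[k --> \oo] --> Rez (F xi).
        by move: h1; rewrite -(cvg_shiftn j); under eq_fun do rewrite addnC.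
      have s2 : Imz (S (n_ (j + k)) xi) @[k --> \oo] --> Imz (F xi).
        by move: h2; rewrite -(cvg_shiftn j); under eq_fun do rewrite addnC.
      apply/esym; apply: (cvg_limn_einf_sup _).1.
      apply: cvg_EFin; first exact: nearW.
      have -> : normc (S N xi - F xi) ^+ 2 =
          (Rez (F xi) - Rez (S N xi)) * (Rez (F xi) - Rez (S N xi)) +
          (Imz (F xi) - Imz (S N xi)) * (Imz (F xi) - Imz (S N xi)).
        by rewrite normc_sqE re_add im_add re_opp im_opp; ring.
      rewrite (_ : fine \o _ = (fun k =>
          (Rez (S (n_ (j + k)) xi) - Rez (S N xi)) * (Rez (S (n_ (j + k)) xi) - Rez (S N xi)) +
          (Imz (S (n_ (j + k)) xi) - Imz (S N xi)) * (Imz (S (n_ (j + k)) xi) - Imz (S N xi)))).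
        by apply: cvgD; apply: cvgM; apply: cvgB => //; exact: cvg_cst.
      by apply/funext => k /=; rewrite normc_sqE re_add im_add re_opp im_opp !expr2.
  apply: le_trans (fatou lam mU mf _) _; first by move=> k xi _.
  apply: limn_einf_le => k.
  have -> : (\int[lam]_(xi in U) f k xi = (sqnorm U (fun xi => S (n_ (j + k)) xi - S N xi))%:E)%E.
    by rewrite -sqnormE.
  by rewrite lee_fin sqS hE // leq_addr.
have c4 : (4^-1 : R) ^+ j @[j --> \oo] --> (0 : R).
  by apply: cvg_expr; rewrite ger0_norm; lra.
have fin N : (n_ 0 <= N)%N -> sqnorm_integral U (fun xi => S N xi - F xi) \is a fin_num.
  move=> N0; rewrite ge0_fin_numE; last exact: sqnorm_integral_ge0.
  by apply: le_lt_trans (bnd _ _ N0) _; rewrite ltry.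
apply/fine_cvgP; split; first by exists (n_ 0).
apply/cvgr0Pnorm_lt => e e0.
have /cvgr0Pnorm_lt /(_ e e0) [j _ /(_ j (leqnn j)) /= hj] := c4.
exists (maxn (n_ 0) (n_ j)) => // N /=; rewrite geq_max => /andP[N0 Nj].
rewrite ger0_norm; last by rewrite fine_ge0 // sqnorm_integral_ge0.
apply: le_lt_trans hj; apply: le_trans (ler_norm _).
by rewrite -lee_fin fineK ?fin // bnd.
Qed.

End RieszFischer.

(** * The transform and its joint measurability *)

Section ComplexLimits.
Context d (T : measurableType d) {R : realType}.

(** A total, measurable choice of the pointwise limit of a sequence of complex
    functions; it is the limit wherever there is one. *)
Definition climit (u : nat -> T -> R[i]) (x : T) : R[i] :=
  fine (limn_esup (fun k => (Rez (u k x))%:E)) +i*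
  fine (limn_esup (fun k => (Imz (u k x))%:E)).

Lemma cmeasurable_climit (D : set T) (u : nat -> T -> R[i]) :
  (forall k, cmeasurable D (u k)) -> cmeasurable D (climit u).
Proof.
move=> mu; split=> /=; apply: (measurableT_comp (@fine_measurable _ setT measurableT));
  apply: measurable_fun_limn_esup => k; apply/measurable_EFinP;
  [exact: (mu k).1|exact: (mu k).2].
Qed.

Lemma climitE (u : nat -> T -> R[i]) x w : ccvg (fun k => u k x) w -> climit u x = w.
Proof.
move=> [h1 h2]; apply: complex_ext => /=.
- have e : (Rez (u k x))%:E @[k --> \oo] --> (Rez w)%:E.
    by apply: cvg_EFin; [exact: nearW|exact: h1].
  by rewrite (cvg_limn_einf_sup e).2.
- have e : (Imz (u k x))%:E @[k --> \oo] --> (Imz w)%:E.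
    by apply: cvg_EFin; [exact: nearW|exact: h2].
  by rewrite (cvg_limn_einf_sup e).2.
Qed.

End ComplexLimits.

Section MeasurableSelection.
Context d (T : measurableType d) {R : realType}.

Definition first_index (B : nat -> set T) (x : T) : nat :=
  xget 0 [set N | B N x /\ forall i, (i < N)%N -> ~ B i x].

Lemma first_indexP (B : nat -> set T) x : (exists N, B N x) ->
  B (first_index B x) x /\ forall i, (i < first_index B x)%N -> ~ B i x.
Proof.
move=> [N BN]; rewrite /first_index.
have exB : exists N, `[< B N x >] by exists N; exact/asboolP.
apply: (@xgetPex _ 0 [set N | B N x /\ forall i, (i < N)%N -> ~ B i x]).
exists (ex_minn exB); case: ex_minnP => M /asboolP BM minM; split=> // i iM Bi.
by have := minM i (asboolT Bi); rewrite leqNgt iM.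
Qed.

Lemma measurable_first_index (D : set T) (B : nat -> set T) N : measurable D ->
  (forall i, measurable (D `&` B i)) -> measurable (D `&` [set x | first_index B x = N]).
Proof.
move=> mD mB.
pose A i := (D `&` B i) `\` \bigcup_(k in [set k | (k < i)%N]) (D `&` B k).
have mA i : measurable (A i).
  by apply: measurableD => //; apply: bigcup_measurable => k _; exact: mB.
have Auniq x i k : A i x -> A k x -> i = k.
  move=> [[Dx Bi] ni] [[_ Bk] nk]; apply/eqP; case: ltngtP => // h.
  - by case: nk; exists i.
  - by case: ni; exists k.
have AE x i : D x -> A i x <-> (B i x /\ forall k, (k < i)%N -> ~ B k x).
  move=> Dx; split=> [[[_ Bi] ni]|[Bi ni]].
    by split=> // k ki Bk; apply: ni; exists k.
  by split=> // -[k /= ki [_ Bk]]; exact: (ni k).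
have E : D `&` [set x | first_index B x = N] =
    A N `|` (if N == 0 then D `\` \bigcup_i (D `&` B i) else set0).
  apply/seteqP; split=> [x [Dx /= fN]|x].
    have [exB|nB] := pselect (exists i, B i x).
      by left; apply/(AE x N Dx); rewrite -fN; exact: first_indexP.
    right; rewrite -fN /first_index; case: xgetP => [y _ [By _]|_].
      by case: nB; exists y.
    by rewrite eqxx; split=> // -[i _ [_ Bi]]; apply: nB; exists i.
  move=> [AN|].
    have Dx : D x by case: AN => -[].
    split=> //=; rewrite /first_index; case: xgetP => [y _ /(AE x y Dx) Ay|/(_ N) nN].
      exact: Auniq Ay AN.
    by case: nN; exact/(AE x N Dx).
  case: eqP => [->|//] [Dx nB]; split=> //=.
  rewrite /first_index; case: xgetP => // y _ [By _].
  by case: nB; exists y.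
rewrite E; apply: measurableU => //; case: ifP => _; last exact: measurable0.
by apply: measurableD => //; exact: bigcupT_measurable.
Qed.

Lemma measurable_select d' (T' : measurableType d') (D : set T) (g : T -> nat)
    (h : nat -> T -> T') : measurable D ->
  (forall N, measurable (D `&` [set x | g x = N])) ->
  (forall N, measurable_fun D (h N)) ->
  measurable_fun D (fun x => h (g x) x).
Proof.
move=> mD mg mh _ Y mY.
have -> : D `&` (fun x => h (g x) x) @^-1` Y =
    \bigcup_N ((D `&` [set x | g x = N]) `&` (D `&` h N @^-1` Y)).
  apply/seteqP; split=> [x [Dx Yx]|x [N _ [[Dx /= gN] [_ Yx]]]].
    by exists (g x).
  by split=> //=; rewrite gN.
by apply: bigcupT_measurable => N; apply: measurableI => //; exact: mh.
Qed.

End MeasurableSelection.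

Section ThetaTransform.
Context {R : realType}.
Local Notation lam := (@lebesgue_measure R).
Local Notation mR := (measurableTypeR R).
Local Notation U := (`[0, 1[%classic : set mR).
Variables (a : R) (a1 : 1 < a).
Implicit Types f : R -> R[i].

Let a0 : 0 < a. Proof. exact: lt_trans a1. Qed.

(** At a fixed [x], the Fourier coefficients of the transform of [f]. *)
Definition dilates f (x : R) (l : int) : R[i] := (a `^ (l%:~R / 2))%:C * f (a ^ l * x).

Lemma sqr_powR_half (l : int) : (a `^ (l%:~R / 2)) ^+ 2 = a ^ l.
Proof.
by rewrite -powR_mulrn ?powR_ge0 // -powRrM divfK // powR_intmul // ltW.
Qed.

Lemma energy_dilates f x N :
  energy (dilates f x) N = periodize a (fun y => normc (f y) ^+ 2) N x.
Proof. by apply: eq_bigr => k _; rewrite normc_sqM normc_sqC sqr_powR_half. Qed.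

Lemma measurable_sq f : L2 f -> measurable_fun (Rplus R) (fun y : mR => normc (f y) ^+ 2 : mR).
Proof. by move=> [mf _]; exact: measurable_normc_sq. Qed.

Lemma cmeasurable_dilates f l : cmeasurable (Rplus R) (f : mR -> R[i]) ->
  cmeasurable (Rplus R) (fun x : mR => dilates f x l).
Proof.
move=> [f1 f2]; apply: cmeasurableM; first exact: cmeasurable_cst.
have al0 : 0 < a ^ l by exact: exprz_gt0.
by split; [exact: measurable_dilated al0 f1|exact: measurable_dilated al0 f2].
Qed.

Lemma measurable_energy f N : cmeasurable (Rplus R) (f : mR -> R[i]) ->
  measurable_fun (Rplus R) (fun x : mR => energy (dilates f x) N : mR).
Proof.
move=> hf; apply: measurable_sum => k; apply: measurable_normc_sq.
exact: cmeasurable_dilates.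
Qed.

Lemma integral_energy_le f N (b : R) : 0 < b -> L2 f ->
  (\int[lam]_(x in `[b, (a * b)%R[) (energy (dilates f x) N)%:E <=
   sqnorm_integral (Rplus R) f)%E.
Proof.
move=> b0 hf; under eq_integral do rewrite energy_dilates.
apply: ge0_integral_periodize_le => //; first exact: measurable_sq.
by move=> x _; exact: sqr_ge0.
Qed.

(** The integral of the squared norm of the coefficients over a period is the
    squared norm of [f], and countably many periods cover the half-line. *)
Lemma ae_energy_bounded f : L2 f -> {ae lam, forall x, Rplus R x ->
  exists M, forall N, energy (dilates f x) N <= M}.
Proof.
move=> hf; have [_ f2] := hf.
have step (b : R) : 0 < b -> {ae lam, forall x, `[b, a * b[%classic x ->
    exists M, forall N, energy (dilates f x) N <= M}.
  move=> b0; apply: (@ae_bounded_of_integral _ _ _ lam `[b, a * b[%classic _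
    (fun N x => energy (dilates f x) N) (sqnorm (Rplus R) f)).
  - exact: measurable_itv.
  - move=> N; have m1 : measurable_fun (Rplus R) (fun x : mR => energy (dilates f x) N).
      exact: measurable_energy hf.1.
    by apply: (measurable_funS (measurable_Rplus (R := R)) _ m1); exact: period1_subset.
  - by move=> N x _; exact: energy_ge0.
  - by move=> x _ n m; exact: le_energy.
  - by move=> N; rewrite -sqnormE //; exact: integral_energy_le.
have : {ae lam, forall x, forall n m : nat,
    `[a ^ (n%:Z - m%:Z), a * a ^ (n%:Z - m%:Z)[%classic x ->
    exists M, forall N, energy (dilates f x) N <= M}.
  apply: ae_foralln => n; apply: ae_foralln => m; apply: step; exact: exprz_gt0.
apply: ae_mono => x h; rewrite /Rplus /= in_itv /= andbT => x0.
have := dilation_indexP a1 x0; set j := dilation_index a x => jx.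
have [n [m jnm]] : exists n m : nat, j = n%:Z - m%:Z.
  by case: (j) => k; [exists k, 0|exists 0, k.+1]; rewrite ?subr0 ?sub0r ?NegzE.
by apply: (h n m); rewrite /= in_itv /= -jnm -expfz_succ.
Qed.

Lemma measurable_fst_comp d' (T' : measurableType d') (h : mR -> T') :
  measurable_fun (Rplus R) h ->
  measurable_fun (Rplus R `*` setT) (fun z : mR * mR => h z.1).
Proof.
move=> mh; apply: (@measurable_comp _ _ _ _ _ _ (Rplus R)) => //.
- exact: measurable_Rplus.
- by move=> _ [z [z1 _] <-].
- by apply: measurable_funTS; exact: measurable_fst.
Qed.

Let D : set (mR * mR) := Rplus R `*` setT.

Let mD : measurable D.
Proof. by apply: measurableX => //; exact: measurable_Rplus. Qed.

Lemma cmeasurable_fourier_sum_dilates f N : L2 f ->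
  cmeasurable D (fun z : mR * mR => fourier_sum (dilates f z.1) N z.2).
Proof.
move=> hf; apply: cmeasurable_sum => k; apply: cmeasurableM.
  have [h1 h2] := cmeasurable_dilates (k%:Z - N%:Z) hf.1.
  by split; [exact: (measurable_fst_comp h1)|exact: (measurable_fst_comp h2)].
apply: cmeasurable_expi; apply: measurable_funN.
apply: measurable_funM; first exact: measurable_cst.
by apply: measurable_funTS; exact: measurable_snd.
Qed.

Lemma measurable_section d' (T' : measurableType d') (F : mR * mR -> T') (x : R) :
  0 < x -> measurable_fun D F -> measurable_fun setT (fun xi : mR => F (x, xi)).
Proof.
move=> x0 mF; apply: (@measurable_comp _ _ _ _ _ _ D) => //.
by move=> _ [xi _ <-]; split=> //=; rewrite /Rplus /= in_itv /= andbT.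
Qed.

Lemma cmeasurable_section (F : mR * mR -> R[i]) (x : R) :
  0 < x -> cmeasurable D F -> cmeasurable U (fun xi : mR => F (x, xi)).
Proof.
move=> x0 [F1 F2]; split; apply: measurable_funTS;
  [exact: (measurable_section x0 F1)|exact: (measurable_section x0 F2)].
Qed.

(** For almost every [x] the coefficients are square-summable, but the speed of
    convergence of the Fourier series depends on [x]. At stage [k] the series is
    cut at the first index beyond which the tail has squared norm at most
    [4 ^ (- k)]; this index is a measurable function of [x], so the limit of these
    sums is jointly measurable. *)
Lemma is_Theta_exists f : L2 f -> exists F, is_Theta a f F.
Proof.
move=> hf.
pose B k N : set (mR * mR) := [set z | forall M,
  energy (dilates f z.1) M <= energy (dilates f z.1) N + (4^-1) ^+ k].
pose g k (z : mR * mR) := first_index (B k) z.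
have mB k N : measurable (D `&` B k N).
  have -> : D `&` B k N = \bigcap_M (D `&` [set z |
      energy (dilates f z.1) M <= energy (dilates f z.1) N + (4^-1) ^+ k]).
    apply/seteqP; split=> [z [Dz Bz] M _|z h]; first by split=> //; exact: Bz.
    by split=> [|M]; [exact: (h 0 I).1|exact: (h M I).2].
  apply: bigcapT_measurable => M; apply: measurable_fun_le => //.
    by apply: (measurable_fst_comp (measurable_energy M hf.1)).
  apply: measurable_funD; last exact: measurable_cst.
  by apply: (measurable_fst_comp (measurable_energy N hf.1)).
pose S k (z : mR * mR) := fourier_sum (dilates f z.1) (g k z) z.2.
have mS k : cmeasurable D (S k).
  have mg N : measurable (D `&` [set z | g k z = N]) by exact: measurable_first_index.
  split; [apply: (@measurable_select _ _ _ _ D (g k) 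
      (fun N z => Rez (fourier_sum (dilates f z.1) N z.2))) => // N|
          apply: (@measurable_select _ _ _ _ D (g k) 
      (fun N z => Imz (fourier_sum (dilates f z.1) N z.2))) => // N].
  - exact: (cmeasurable_fourier_sum_dilates N hf).1.
  - exact: (cmeasurable_fourier_sum_dilates N hf).2.
pose F := climit S.
have mF : cmeasurable D F by exact: cmeasurable_climit.
exists F; split=> //.
  move=> x xi x0; rewrite /F /climit.
  have SE k : S k (x, xi + 1) = S k (x, xi) by rewrite /S /= fourier_sum_periodic.
  by under eq_fun do rewrite SE; under [in X in _ +i* X]eq_fun do rewrite SE.
apply: ae_mono (ae_energy_bounded hf) => x bx Rx; have [M hM] := bx Rx.
have x0 : 0 < x by move: Rx; rewrite /Rplus /= in_itv /= andbT.
set c := dilates f x in hM *.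
have hg k N : energy c N <= energy c (g k (x, 0)) + (4^-1) ^+ k.
  suff : exists n, B k n (x, 0) by move=> /first_indexP[h _]; exact: h.
  have p0 : (0 : R) < (4^-1) ^+ k by rewrite exprn_gt0 // invr_gt0.
  have hs : has_sup (range (energy c)).
    by split; [exists (energy c 0), 0|exists M => _ [n _ <-]].
  have [_ [n _ <-] hn] := sup_adherent p0 hs.
  exists n => m /=; have : energy c m <= sup (range (energy c)).
    by apply: ub_le_sup; [case: hs|exists m].
  by rewrite -/c; lra.
pose n_ k := g k (x, 0).
have Sx k xi : S k (x, xi) = fourier_sum c (n_ k) xi by [].
apply: (fourier_series_of_ccvg (n_ := n_) hg _ _).2.
  exact: cmeasurable_section.
apply: ae_mono (ae_ccvg_fourier_sum hg) => xi h Uxi; have [w hw] := h Uxi.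
by rewrite /F (climitE (w := w)).
Qed.

Lemma ThetaP f : L2 f -> is_Theta a f (Theta a f).
Proof. by move=> hf; apply: xgetPex; exact: is_Theta_exists. Qed.

Lemma cmeasurable_Theta f : L2 f -> cmeasurable D (Theta a f).
Proof. by move=> /ThetaP[]. Qed.

Lemma Theta_fourier_series f : L2 f -> {ae lam, forall x, Rplus R x ->
  fourier_series (dilates f x) (fun xi => Theta a f (x, xi))}.
Proof.
move=> hf; have [mF _ cF] := ThetaP hf.
apply: ae_mono cF => x hx Rx; split; last exact: hx.
by apply: cmeasurable_section mF; move: Rx; rewrite /Rplus /= in_itv /= andbT.
Qed.

End ThetaTransform.

(** * Inner products with the atoms *)

Section DilationIndex.
Context {R : realType}.
Local Notation mR := (measurableTypeR R).
Variables (a : R) (a1 : 1 < a).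

Lemma measurable_dilation_index :
  measurable_fun setT (fun x : mR => (dilation_index a x)%:~R : mR).
Proof.
have mfloor : measurable_fun setT (fun t : mR => (Num.floor t)%:~R : mR).
  apply: nondecreasing_measurable => // x y xy.
  by rewrite ler_int Num.Theory.floor_ge_int (le_trans _ xy) // ge_floor.
apply: (measurableT_comp mfloor).
by apply: measurable_funM; [exact: measurable_ln|exact: measurable_cst].
Qed.

Lemma measurable_exprz_dilation_index :
  measurable_fun setT (fun x : mR => a ^ dilation_index a x : mR).
Proof.
have -> : (fun x : mR => a ^ dilation_index a x) =
    powR a \o (fun x : mR => (dilation_index a x)%:~R).
  by apply/funext => x /=; rewrite powR_intmul // ltW // (lt_trans ltr01).
apply: measurableT_comp; first exact: measurable_powRr.
exact: measurable_dilation_index.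
Qed.

Lemma measurable_fold :
  measurable_fun setT (fun x : mR => x / a ^ dilation_index a x : mR).
Proof.
apply: measurable_funM => //.
have -> : (fun x : mR => (a ^ dilation_index a x)^-1) =
    (fun y => powR y (-1)) \o (fun x : mR => a ^ dilation_index a x).
  apply/funext => x /=; rewrite powR_inv1 // exprz_ge0 // ltW // (lt_trans ltr01) //.
apply: measurableT_comp; first exact: measurable_powR.
exact: measurable_exprz_dilation_index.
Qed.

End DilationIndex.

Section InnerProducts.
Context {R : realType}.
Local Notation lam := (@lebesgue_measure R).
Local Notation mR := (measurableTypeR R).
Local Notation U := (`[0, 1[%classic : set mR).
Variables (a : R) (a1 : 1 < a).
Implicit Types (f psi : R -> R[i]) (m j l : int).

Let a0 : 0 < a. Proof. exact: lt_trans a1. Qed.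
Let ap l : 0 < a ^ l. Proof. exact: exprz_gt0. Qed.

Lemma Lambda_periodicz l m x : 0 < x -> Lambda a m (a ^ l * x) = Lambda a m x.
Proof.
have nat_case (n : nat) y : 0 < y -> Lambda a m (a ^+ n * y) = Lambda a m y.
  move=> y0; elim: n => [|n IH]; first by rewrite mul1r.
  by rewrite exprS -mulrA Lambda_periodic // mulr_gt0 // exprn_gt0.
case: l => n x0; first exact: nat_case.
rewrite NegzE; set y := a ^ _ * x.
have y0 : 0 < y by rewrite mulr_gt0.
rewrite -(nat_case n.+1 y y0) /y mulrA exprnP -expfzDr ?gt_eqF //.
by rewrite subrr expr0z mul1r.
Qed.

Lemma normc_Lambda m x : normc (Lambda a m x) ^+ 2 = (a - 1)^-1.
Proof.
rewrite normc_sqM normc_expi mulr1 normc_sqC exprVn sqr_sqrtr // subr_ge0 ltW //.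
Qed.

Lemma cmeasurable_Lambda m : cmeasurable setT (Lambda a m : mR -> R[i]).
Proof.
apply: cmeasurableM; first exact: cmeasurable_cst.
apply: cmeasurable_expi; apply: measurable_funM; last exact: measurable_cst.
apply: measurable_funM; first exact: measurable_cst.
exact: measurable_fold.
Qed.

Lemma L2_dilate (c : R) psi : 0 < c -> L2 psi -> L2 (dilate c psi).
Proof.
move=> c0 [[p1 p2] p3].
have mp : cmeasurable (Rplus R) (fun x : mR => psi (c * x)).
  by split; [exact: measurable_dilated c0 p1|exact: measurable_dilated c0 p2].
split; first by apply: cmeasurableM => //; exact: cmeasurable_cst.
move: p3; rewrite /sqnorm_integral (ge0_integral_dilation c0) //; last 3 first.
- exact: measurable_Rplus.
- by apply/measurable_EFinP; apply: measurable_normc_sq; split.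
- by move=> x _; rewrite lee_fin sqr_ge0.
rewrite dilated_Rplus // -ge0_integralZl_EFin ?(ltW c0) //; last 3 first.
- exact: measurable_Rplus.
- by move=> x _; rewrite lee_fin sqr_ge0.
- by apply/measurable_EFinP; exact: measurable_normc_sq.
congr (_ < _)%E; apply: eq_integral => x _.
by rewrite /dilate normc_sqM normc_sqC sqr_sqrtr ?EFinM // ltW.
Qed.

Lemma L2_atom m j psi : L2 psi -> L2 (fun x => Lambda a m x * dilate (a ^ j) psi x).
Proof.
move=> hpsi.
apply: (@square_integrable_bounded _ _ (measurable_Rplus (R := R)) _ _ (a - 1)^-1).
- have [l1 l2] := cmeasurable_Lambda m.
  by split; exact: measurable_funTS.
- exact: L2_dilate.
- by move=> x _; rewrite normc_Lambda.
Qed.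

Definition correlation f psi j N x : R[i] :=
  \sum_(k < (2 * N).+1)
    dilates a f x (k%:Z - N%:Z) * conjc (dilates a psi x (k%:Z - N%:Z + j)).

Lemma sqrt_exprz j : Num.sqrt (a ^ j) = a `^ (j%:~R / 2).
Proof. by rewrite -(sqr_powR_half a1) sqrtr_sqr ger0_norm // powR_ge0. Qed.

Lemma correlation_term f psi m j l x : 0 < x ->
  (a ^ l)%:C * (f (a ^ l * x) *
    conjc (Lambda a m (a ^ l * x) * dilate (a ^ j) psi (a ^ l * x))) =
  conjc (Lambda a m x) * (dilates a f x l * conjc (dilates a psi x (l + j))).
Proof.
move=> x0; rewrite Lambda_periodicz // /dilate /dilates (conj_mul (Lambda a m x)).
move: (conjc (Lambda a m x)) => z2.
rewrite !(conj_mul _%:C) !conjc_real sqrt_exprz.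
have -> : a ^ j * (a ^ l * x) = a ^ (l + j) * x.
  by rewrite expfzDr ?gt_eqF //; ring.
have E : a ^ l * a `^ (j%:~R / 2) = a `^ (l%:~R / 2) * a `^ ((l + j)%:~R / 2).
  have an0 : a != 0 by rewrite gt_eqF.
  rewrite -powR_intmul ?(ltW a0) // -!powRD ?an0 ?implybT //.
  by congr (_ `^ _); rewrite intrD; field.
have {}E : (a ^ l)%:C * (a `^ (j%:~R / 2))%:C =
    (a `^ (l%:~R / 2))%:C * (a `^ ((l + j)%:~R / 2))%:C :> R[i].
  by rewrite -!rmorphM /= E.
set z1 := f _; set z3 := conjc (psi _).
transitivity (((a ^ l)%:C * (a `^ (j%:~R / 2))%:C) * (z1 * z2 * z3)); first by ring.
by rewrite E; ring.
Qed.

(** Periodization turns the integral over the half-line into an integral over the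
    period, since [Lambda] is dilation periodic. *)
Lemma inner_cvg f psi m j : L2 f -> L2 psi ->
  ccvg (fun N => cintegral (`[1, a[%classic : set mR)
                   (fun x => conjc (Lambda a m x) * correlation f psi j N x))
       (inner f (fun x => Lambda a m x * dilate (a ^ j) psi x)).
Proof.
move=> hf hpsi.
pose k x := f x * conjc (Lambda a m x * dilate (a ^ j) psi x).
have mRp := measurable_Rplus (R := R).
have [k1 k2] : cintegrable (Rplus R) k.
  by apply: cintegrableM => //; apply: square_integrableJ => //; exact: L2_atom.
have kE N x : 0 < x -> \sum_(i < (2 * N).+1) (a ^ (i%:Z - N%:Z))%:C * k (a ^ (i%:Z - N%:Z) * x) =
    conjc (Lambda a m x) * correlation f psi j N x.
  by move=> x0; rewrite mulr_sumr; apply: eq_bigr => i _; exact: correlation_term.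
have pos x : `[1, a[%classic x -> 0 < x.
  by rewrite /= in_itv /= => /andP[x1 _]; exact: lt_le_trans x1.
split.
- have := Rintegral_periodize a1 ltr01 k1; rewrite mulr1.
  apply: cvg_trans; apply: near_eq_cvg; apply: nearW => N.
  rewrite Re_cintegral; apply: eq_Rintegral => x; rewrite inE => /pos x0.
  rewrite -kE // Re_sum; apply: eq_bigr => i _.
  by rewrite [RHS]re_mul [X in _ - X * _]/= mul0r subr0.
- have := Rintegral_periodize a1 ltr01 k2; rewrite mulr1.
  apply: cvg_trans; apply: near_eq_cvg; apply: nearW => N.
  rewrite Im_cintegral; apply: eq_Rintegral => x; rewrite inE => /pos x0.
  rewrite -kE // Im_sum; apply: eq_bigr => i _.
  by rewrite [RHS]im_mul [X in _ + X * _]/= mul0r addr0.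
Qed.

End InnerProducts.

(** * The orthogonality criterion *)

Section DominatedConvergence.
Context {R : realType}.
Local Notation lam := (@lebesgue_measure R).
Local Notation mR := (measurableTypeR R).

Lemma Rintegral_dominated (D : set mR) (u : nat -> R -> R) (v : R -> R) (h : R -> \bar R) :
  measurable D -> (forall n, measurable_fun D (u n : mR -> R)) ->
  measurable_fun D (v : mR -> R) ->
  {ae lam, forall x, D x -> u n x @[n --> \oo] --> v x} ->
  lam.-integrable D (h : mR -> \bar R) ->
  (forall n x, D x -> (`|u n x|%:E <= h x)%E) ->
  lam.-integrable D (EFin \o v) /\
  \int[lam]_(x in D) u n x @[n --> \oo] --> \int[lam]_(x in D) v x.
Proof.
move=> mD mu mv uv ih uh.
have [] := @dominated_convergence _ _ _ lam D mD (fun n => EFin \o u n) (EFin \o v) h.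
- by move=> n; apply/measurable_EFinP; exact: mu.
- by apply/measurable_EFinP; exact: mv.
- apply: ae_mono uv => x c Dx.
  by apply: cvg_EFin; [exact: nearW|exact: c].
- exact: ih.
- by apply: aeW => x n Dx; exact: uh.
move=> iv _ c; split=> //.
apply: fine_cvg; rewrite /Rintegral fineK //; exact: integrable_fin_num.
Qed.

Lemma cintegral_dominated (D : set mR) (u : nat -> R -> R[i]) (v : R -> R[i])
    (h : R -> \bar R) : measurable D ->
  (forall n, cmeasurable D (u n : mR -> R[i])) -> cmeasurable D (v : mR -> R[i]) ->
  {ae lam, forall x, D x -> ccvg (fun n => u n x) (v x)} ->
  lam.-integrable D (h : mR -> \bar R) ->
  (forall n x, D x -> (`|Rez (u n x)|%:E <= h x)%E /\ (`|Imz (u n x)|%:E <= h x)%E) ->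
  cintegrable D v /\ ccvg (fun n => cintegral D (u n)) (cintegral D v).
Proof.
move=> mD mu mv uv ih uh.
have uv1 : {ae lam, forall x, D x -> Rez (u n x) @[n --> \oo] --> Rez (v x)}.
  by apply: ae_mono uv => x c Dx; exact: (c Dx).1.
have uv2 : {ae lam, forall x, D x -> Imz (u n x) @[n --> \oo] --> Imz (v x)}.
  by apply: ae_mono uv => x c Dx; exact: (c Dx).2.
have [i1 c1] := @Rintegral_dominated D (fun n x => Rez (u n x)) (fun x => Rez (v x)) h
  mD (fun n => (mu n).1) mv.1 uv1 ih (fun n x Dx => (uh n x Dx).1).
have [i2 c2] := @Rintegral_dominated D (fun n x => Imz (u n x)) (fun x => Imz (v x)) h
  mD (fun n => (mu n).2) mv.2 uv2 ih (fun n x Dx => (uh n x Dx).2).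
by [].
Qed.

Lemma ae_eq0_cintegral (D : set mR) (v : R -> R[i]) : measurable D ->
  cmeasurable D (v : mR -> R[i]) ->
  {ae lam, forall x, D x -> v x = 0} -> cintegral D v = 0.
Proof.
move=> mD [m1 m2] v0.
apply: complex_ext; rewrite !(Re_cintegral, Im_cintegral) /Rintegral /=.
- rewrite (ae_eq_integral (cst 0%E)) ?integral0 //.
    by apply/measurable_EFinP.
  by apply: ae_mono v0 => x h Dx /=; rewrite h.
- rewrite (ae_eq_integral (cst 0%E)) ?integral0 //.
    by apply/measurable_EFinP.
  by apply: ae_mono v0 => x h Dx /=; rewrite h.
Qed.

End DominatedConvergence.

Section OrthogonalityCriterion.
Context {R : realType}.
Local Notation lam := (@lebesgue_measure R).
Local Notation mR := (measurableTypeR R).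
Local Notation U := (`[0, 1[%classic : set mR).
Variables (a : R) (a1 : 1 < a).
Local Notation I := (`[1, a[%classic : set mR).

Let a0 : 0 < a. Proof. exact: lt_trans a1. Qed.
Let mI : measurable I. Proof. exact: measurable_itv. Qed.
Let mU : measurable U. Proof. exact: measurable_itv. Qed.
Let mRp : measurable (Rplus R). Proof. exact: measurable_Rplus. Qed.

Lemma fundamental_period_subset : I `<=` Rplus R.
Proof.
by move=> x; rewrite /Rplus /= !in_itv /= andbT => /andP[h _]; exact: lt_le_trans h.
Qed.

Definition total_energy f (x : R) : \bar R := limn (fun N => (energy (dilates a f x) N)%:E).

Lemma integrable_total_energy f : L2 f ->
  lam.-integrable I (total_energy f : mR -> \bar R).
Proof.
move=> hf; apply: (@integrable_limn_nondecreasing _ _ _ lam I mI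
  (fun N x => energy (dilates a f x) N) (sqnorm (Rplus R) f)).
- move=> N; have m1 := measurable_energy a1 N hf.1.
  by apply: (measurable_funS mRp _ m1); exact: fundamental_period_subset.
- by move=> N x _; exact: energy_ge0.
- by move=> x _ n m; exact: le_energy.
- move=> N; rewrite -sqnormE //.
  by have := integral_energy_le a1 N ltr01 hf; rewrite mulr1.
Qed.

Lemma energy_le_total f N x : ((energy (dilates a f x) N)%:E <= total_energy f x)%E.
Proof.
apply: (@le_limn_nondecreasing _ _ _ setT (fun N x => energy (dilates a f x) N)) => //.
by move=> y _ n m; exact: le_energy.
Qed.

Variables (f psi : R -> R[i]) (hf : L2 f) (hpsi : L2 psi).

Lemma cmeasurable_correlation j N : cmeasurable I (correlation a f psi j N : mR -> R[i]).
Proof.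
apply: cmeasurable_sum => k; apply: cmeasurableM; last apply: cmeasurableJ;
  apply: (cmeasurableS mRp fundamental_period_subset).
- exact: cmeasurable_dilates hf.1.
- exact: cmeasurable_dilates hpsi.1.
Qed.

Lemma energy_shift (c : int -> R[i]) j N :
  \sum_(k < (2 * N).+1) normc (c (k%:Z - N%:Z + j)) ^+ 2 <= energy c (N + `|j|).
Proof.
pose F (i : nat) := normc (c (i%:Z - (N + `|j|)%N%:Z)) ^+ 2.
have F0 i : 0 <= F i by rewrite sqr_ge0.
have -> : energy c (N + `|j|) = \sum_(0 <= i < (2 * (N + `|j|)).+1) F i.
  by rewrite /energy big_mkord.
pose s := absz (j + `|j|%:Z).
have sE : s%:Z = j + `|j|%:Z by rewrite /s; lia.
have -> : \sum_(k < (2 * N).+1) normc (c (k%:Z - N%:Z + j)) ^+ 2 =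
    \sum_(s <= i < (2 * N).+1 + s) F i.
  rewrite -[in RHS](add0n s) big_addn add0n addnK big_mkord; apply: eq_bigr => k _; rewrite /F.
  by congr (normc (c _) ^+ 2); rewrite !PoszD sE; lia.
have h1 : (s <= (2 * N).+1 + s)%N by lia.
have h2 : ((2 * N).+1 + s <= (2 * (N + `|j|)).+1)%N by lia.
rewrite (@big_cat_nat _ _ _ s 0%N (2 * (N + `|j|)).+1) //=; last exact: leq_trans h2.
rewrite (@big_cat_nat _ _ _ ((2 * N).+1 + s) s (2 * (N + `|j|)).+1) //=.
have p1 : 0 <= \sum_(0 <= i < s) F i by exact: sumr_ge0.
have p2 : 0 <= \sum_((2 * N).+1 + s <= i < (2 * (N + `|j|)).+1) F i by exact: sumr_ge0.
by lra.
Qed.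

(** A bound that does not depend on [N], for dominated convergence. *)
Lemma correlation_le (z : R[i]) (K : R) j N x : normc z ^+ 2 <= K ->
  (`|Rez (z * correlation a f psi j N x)|%:E <=
    K%:E * total_energy f x + total_energy psi x)%E /\
  (`|Imz (z * correlation a f psi j N x)|%:E <=
    K%:E * total_energy f x + total_energy psi x)%E.
Proof.
move=> zK; have K0 : 0 <= K by apply: le_trans zK; exact: sqr_ge0.
pose B := K * energy (dilates a f x) N + energy (dilates a psi x) (N + `|j|).
have BH : (B%:E <= K%:E * total_energy f x + total_energy psi x)%E.
  rewrite EFinD EFinM; apply: leeD; last exact: energy_le_total.
  by apply: lee_wpmul2l; [rewrite lee_fin|exact: energy_le_total].
have sumB : \sum_(k < (2 * N).+1) (normc (z * dilates a f x (k%:Z - N%:Z)) ^+ 2 +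
    normc (dilates a psi x (k%:Z - N%:Z + j)) ^+ 2) <= B.
  rewrite big_split /=; apply: lerD; last exact: energy_shift.
  under eq_bigr do rewrite normc_sqM.
  by rewrite -mulr_sumr ler_wpM2r // energy_ge0.
have E : z * correlation a f psi j N x = \sum_(k < (2 * N).+1)
    (z * dilates a f x (k%:Z - N%:Z)) * conjc (dilates a psi x (k%:Z - N%:Z + j)).
  by rewrite /correlation mulr_sumr; apply: eq_bigr => k _; rewrite mulrA.
rewrite E; split; apply: le_trans BH; rewrite lee_fin; apply: le_trans sumB.
- rewrite Re_sum; apply: le_trans (ler_norm_sum _ _ _) _; apply: ler_sum => k _.
  by apply: le_trans (normr_ReM_le _ _ ltr01) _; rewrite invr1 !mul1r normc_sqJ.
- rewrite Im_sum; apply: le_trans (ler_norm_sum _ _ _) _; apply: ler_sum => k _.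
  by apply: le_trans (normr_ImM_le _ _ ltr01) _; rewrite invr1 !mul1r normc_sqJ.
Qed.


Definition Theta_product (x xi : R) : R[i] :=
  Theta a f (x, xi) * conjc (Theta a psi (x, xi)).

Lemma ae_Theta_product : {ae lam, forall x, I x ->
  cintegrable U (Theta_product x) /\
  forall j, ccvg (fun N => correlation a f psi j N x) (coef (Theta_product x) (- j))}.
Proof.
apply: ae_mono (ae_and (Theta_fourier_series a1 hf) (Theta_fourier_series a1 hpsi)).
move=> x [cf cpsi] /fundamental_period_subset Rx.
have {}cf := cf Rx; have {}cpsi := cpsi Rx.
have f2 := fourier_series_square_integrable cf.
have psi2 := fourier_series_square_integrable cpsi.
split; first exact: (cintegrableM mU f2 (square_integrableJ mU psi2)).
move=> j; have := fourier_series_pairing_shift j cf psi2.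
rewrite (_ : (fun N => \sum_(k < _) _) = (fun N => correlation a f psi j N x)) //.
apply/funext => N; apply: eq_bigr => k _.
by rewrite (coef_fourier_series _ cpsi).
Qed.

Definition correlation_limit j : R -> R[i] := climit (T := mR) (correlation a f psi j).

Lemma correlation_limitE : {ae lam, forall x, I x -> forall j,
  correlation_limit j x = coef (Theta_product x) (- j)}.
Proof.
by apply: ae_mono ae_Theta_product => x h Ix j; apply: climitE; exact: (h Ix).2.
Qed.

Lemma cmeasurable_correlation_limit j : cmeasurable I (correlation_limit j : mR -> R[i]).
Proof. by apply: cmeasurable_climit => N; exact: cmeasurable_correlation. Qed.

Lemma cintegral_mul_correlation_limit (w : R -> R[i]) (K : R) j :
  cmeasurable I (w : mR -> R[i]) -> (forall x, normc (w x) ^+ 2 <= K) ->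
  cintegrable I (fun x => w x * correlation_limit j x) /\
  ccvg (fun N => cintegral I (fun x => w x * correlation a f psi j N x))
       (cintegral I (fun x => w x * correlation_limit j x)).
Proof.
move=> mw wK.
apply: (@cintegral_dominated _ I (fun N x => w x * correlation a f psi j N x) _
  (fun x => K%:E * total_energy f x + total_energy psi x)%E).
- exact: mI.
- by move=> N; apply: cmeasurableM => //; exact: cmeasurable_correlation.
- by apply: cmeasurableM => //; exact: cmeasurable_correlation_limit.
- apply: ae_mono ae_Theta_product => x h Ix; have [_ /(_ j) c] := h Ix.
  have -> : correlation_limit j x = coef (Theta_product x) (- j) by exact: climitE.
  have [c1 c2] := c; split.
  + rewrite re_mul; under eq_fun do rewrite re_mul.
    by apply: cvgB; apply: cvgM => //; exact: cvg_cst.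
  + rewrite im_mul; under eq_fun do rewrite im_mul.
    by apply: cvgD; apply: cvgM => //; exact: cvg_cst.
- apply: integrableD => //; last exact: integrable_total_energy.
  by apply: integrableZl => //; exact: integrable_total_energy.
- by move=> N x _; exact: correlation_le.
Qed.

Lemma inner_correlation_limit m j :
  inner f (fun x => Lambda a m x * dilate (a ^ j) psi x) =
  cintegral I (fun x => conjc (Lambda a m x) * correlation_limit j x).
Proof.
apply: ccvg_unique (inner_cvg a1 m j hf hpsi) _.
apply: (@cintegral_mul_correlation_limit _ (a - 1)^-1 j _ _).2.
  have [l1 l2] := cmeasurable_Lambda a1 m.
  by apply: cmeasurableJ; split; exact: measurable_funTS.
by move=> x; rewrite normc_sqJ normc_Lambda.
Qed.

(** Orthogonality to all the atoms generated by [psi] says that the correlations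
    of the two coefficient sequences vanish, first in the modulation variable by
    uniqueness of Fourier coefficients on [[1, a)], then in the dilation variable
    by uniqueness on [[0, 1)]. *)
Lemma orthogonal_atomsP :
  (forall m j, inner f (fun x => Lambda a m x * dilate (a ^ j) psi x) = 0) <->
  {ae lam, forall x, I x -> {ae lam, forall xi, U xi -> Theta_product x xi = 0}}.
Proof.
split=> [orth|prod0 m j].
  have lim0 j : {ae lam, forall x, I x -> correlation_limit j x = 0}.
    have n1 (x : R) : normc (1 : R[i]) ^+ 2 <= 1.
      by rewrite ComplexField.Normc.normc1 expr1n.
    have [ih _] := cintegral_mul_correlation_limit j (cmeasurable_cst I 1) n1.
    have E1 : I = `[1, 1 + (a - 1)[%classic by rewrite addrC subrK.
    have T0 : 0 < a - 1 by rewrite subr_gt0.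
    have {}ih : cintegrable I (correlation_limit j).
      rewrite (_ : correlation_limit j = (fun x => 1 * correlation_limit j x)) //.
      by apply/funext => x; rewrite mul1r.
    rewrite E1; apply: fourier_uniqueness => //; rewrite -E1 // => m.
    set s := ((Num.sqrt (a - 1))^-1)%:C : R[i].
    have s0 : s != 0.
      by rewrite /s (fmorph_eq0 (real_complex R)) invr_eq0 gt_eqF // sqrtr_gt0.
    have mL : cmeasurable I (fun x : mR => conjc (Lambda a m x)).
      have [l1 l2] := cmeasurable_Lambda a1 m.
      by apply: cmeasurableJ; split; exact: measurable_funTS.
    have nL x : normc (conjc (Lambda a m x)) ^+ 2 <= (a - 1)^-1.
      by rewrite normc_sqJ normc_Lambda.
    have [iL _] := cintegral_mul_correlation_limit j mL nL.
    transitivity (cintegral I (fun x =>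
        s^-1 * (conjc (Lambda a m x) * correlation_limit j x))).
      apply: eq_cintegral => x Ix; have x1a : 1 <= x < a by move: Ix; rewrite /= in_itv.
      rewrite LambdaE // -/s conj_mul conjc_real.
      rewrite (_ : 2 * pi * m%:~R * x / (a - 1) = 2 * pi / (a - 1) * m%:~R * x); last by ring.
      by rewrite !mulrA mulVf // mul1r mulrC.
    by rewrite cintegralZ // -inner_correlation_limit orth mulr0.
  have : {ae lam, forall x, forall n : nat, I x ->
      correlation_limit n%:Z x = 0 /\ correlation_limit (- n%:Z) x = 0}.
    apply: ae_foralln => n; apply: ae_mono (ae_and (lim0 n%:Z) (lim0 (- n%:Z))).
    by move=> x [h1 h2] Ix; split; [exact: h1|exact: h2].
  move=> lim0'.
  apply: ae_mono (ae_and lim0' (ae_and correlation_limitE ae_Theta_product)).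
  move=> x [l0 [lE P]] Ix; have [ip _] := P Ix.
  apply: coef_eq0 => // l.
  rewrite -[l]opprK -lE //.
  case: l => n; last by rewrite NegzE opprK; exact: (l0 n.+1 Ix).1.
  exact: (l0 n Ix).2.
rewrite inner_correlation_limit; apply: ae_eq0_cintegral => //.
  apply: cmeasurableM; last exact: cmeasurable_correlation_limit.
  have [l1 l2] := cmeasurable_Lambda a1 m.
  by apply: cmeasurableJ; split; exact: measurable_funTS.
apply: ae_mono (ae_and prod0 (ae_and correlation_limitE ae_Theta_product)).
move=> x [p0 [lE P]] Ix; have [[i1 i2] _] := P Ix.
rewrite lE // [coef _ _]ae_eq0_cintegral ?mulr0 //.
  apply: cmeasurableM; last exact/cmeasurableJ/(char_square_integrable _).1.
  by split; apply/measurable_EFinP; [exact: measurable_int i1|exact: measurable_int i2].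
by apply: ae_mono (p0 Ix) => xi h Uxi; rewrite h // mul0r.
Qed.

End OrthogonalityCriterion.

(** * Functions with a prescribed transform *)

Section FunctionsWithPrescribedTransform.
Context {R : realType}.
Local Notation lam := (@lebesgue_measure R).
Local Notation mR := (measurableTypeR R).
Local Notation U := (`[0, 1[%classic : set mR).
Variables (a : R) (a1 : 1 < a).
Local Notation I := (`[1, a[%classic : set mR).

Let a0 : 0 < a. Proof. exact: lt_trans a1. Qed.
Let mU : measurable U. Proof. exact: measurable_itv. Qed.
Let mI : measurable I. Proof. exact: measurable_itv. Qed.
Let mRp : measurable (Rplus R). Proof. exact: measurable_Rplus. Qed.

Lemma measurable_Rintegral_section (K : mR * mR -> R) : measurable_fun setT K ->
  measurable_fun setT (fun x : mR => \int[lam]_(xi in U) K (x, xi)).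
Proof.
move=> mK; pose k z := (K z * \1_U z.2)%:E.
have mk : measurable_fun setT k.
  apply/measurable_EFinP; apply: measurable_funM => //.
  have mi : measurable_fun setT (\1_U : mR -> R) by exact: measurable_indic.
  by apply: (measurableT_comp mi); exact: measurable_snd.
have E x : \int[lam]_(xi in U) K (x, xi) =
    fine (\int[lam]_xi (k^\+)%E (x, xi) - \int[lam]_xi (k^\-)%E (x, xi)).
  rewrite Rintegral_mkcond /Rintegral [in LHS]integralE; congr (fine (_ - _)%E);
    apply: eq_integral => xi _; rewrite ?funeposE ?funenegE /k /= patchE indicE;
    by case: (xi \in _); rewrite ?mulr1 ?mulr0.
rewrite (_ : (fun x => _) = (fun x : mR =>
   fine (\int[lam]_xi (k^\+)%E (x, xi) - \int[lam]_xi (k^\-)%E (x, xi)))); last exact/funext.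
apply: (measurableT_comp (@fine_measurable _ setT measurableT)).
apply: emeasurable_funB.
- apply: (measurable_fun_fubini_tonelli_F (m2 := lam) (k^\+)%E) => //.
  exact: measurable_funepos.
- apply: (measurable_fun_fubini_tonelli_F (m2 := lam) (k^\-)%E) => //.
  exact: measurable_funeneg.
Qed.

Variables (E : set (mR * mR)) (mE : measurable E).

Let mindic : measurable_fun setT (\1_E : mR * mR -> R).
Proof. exact: measurable_indic. Qed.

Definition indicator_fibre (x xi : R) : R[i] := (\1_E (x, xi) : R)%:C.

Lemma indicator_fibre_square_integrable x : square_integrable U (indicator_fibre x).
Proof.
have m1 : cmeasurable U (indicator_fibre x : mR -> R[i]).
  apply: cmeasurable_RC; apply: measurable_funTS.
  apply: (measurableT_comp mindic); exact: pair1_measurable.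
have := @square_integrable_bounded _ U mU (indicator_fibre x) (fun=> 1) 1 m1
  (square_integrable_cst 1).
rewrite (_ : (fun xi => indicator_fibre x xi * 1) = indicator_fibre x); last first.
  by apply/funext => xi; rewrite mulr1.
apply=> xi _; rewrite normc_sqC indicE; case: (_ \in _); rewrite ?expr1n ?expr0n //.
Qed.

Lemma sqnorm_indicator_fibre_le1 x : sqnorm U (indicator_fibre x) <= 1.
Proof.
have h := indicator_fibre_square_integrable x.
apply: (@le_trans _ _ (\int[lam]_(xi in U) (1 : R))); last first.
  by rewrite Rintegral_cst // mul1r fine_lebesgue_unit.
rewrite /sqnorm.
apply: le_Rintegral => //.
- by apply/square_integrableP => //; exact: h.1.
- exact: integrable_cst_itv.
- by move=> xi _; rewrite normc_sqC indicE; case: (_ \in _); rewrite ?expr1n ?expr0n.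
Qed.

(** The inverse transform of an indicator: on the period [[a ^ j, a ^ (j + 1))]
    the function is given by the [j]-th Fourier coefficients of the fibres. *)
Definition inverse_transform (x : R) : R[i] :=
  let j := dilation_index a x in
  (a `^ (- (j%:~R / 2)))%:C * coef (indicator_fibre (x / a ^ j)) j.

Lemma dilates_inverse_transform x l : I x ->
  dilates a inverse_transform x l = coef (indicator_fibre x) l.
Proof.
move=> Ix; have /andP[x1 xa] : 1 <= x < a by move: Ix; rewrite /= in_itv.
have al : 0 < a ^ l by exact: exprz_gt0.
have jE : dilation_index a (a ^ l * x) = l.
  apply: dilation_index_def => //; rewrite (expfz_succ a1) (mulrC a).
  by rewrite ler_pMr // x1 ltr_pM2l.
rewrite /dilates /inverse_transform jE mulrA -rmorphM /= -powRD; last first.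
  by rewrite (gt_eqF a0) implybT.
by rewrite subrr powRr0 mul1r mulrAC divff ?gt_eqF // mul1r.
Qed.

Lemma cmeasurable_inverse_transform : cmeasurable (Rplus R) (inverse_transform : mR -> R[i]).
Proof.
pose K (z : mR * mR) : R[i] :=
  (\1_E (z.1 / a ^ dilation_index a z.1, z.2) : R)%:C *
  conjc (expi (- (2 * pi * (dilation_index a z.1)%:~R * z.2))).
have mK : cmeasurable setT K.
  apply: cmeasurableM.
    apply: cmeasurable_RC; apply: (measurableT_comp mindic).
    apply: measurable_fun_pair; last exact: measurable_snd.
    by apply: (measurableT_comp (measurable_fold a1)); exact: measurable_fst.
  apply/cmeasurableJ/cmeasurable_expi/measurable_funN.
  apply: measurable_funM; last exact: measurable_snd.
  apply: measurable_funM; first exact: measurable_cst.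
  by apply: (measurableT_comp (measurable_dilation_index a)); exact: measurable_fst.
apply: (@cmeasurableS _ _ _ setT) => //.
apply: cmeasurableM.
  apply: cmeasurable_RC; apply: (measurableT_comp (measurable_powRr a)).
  apply: measurable_funN; apply: measurable_funM; last exact: measurable_cst.
  exact: measurable_dilation_index.
by split; [exact: (measurable_Rintegral_section mK.1)|exact: (measurable_Rintegral_section mK.2)].
Qed.

(** By Bessel's inequality the squared norm of the coefficients of a fibre is at
    most [1], so the squared norm of the function is at most [a - 1]. *)
Lemma L2_inverse_transform : L2 inverse_transform.
Proof.
have mf := cmeasurable_inverse_transform; split=> //.
have m2 : measurable_fun (Rplus R) (fun y : mR => normc (inverse_transform y) ^+ 2 : mR).
  exact: measurable_normc_sq.
have c := ge0_integral_periodize a1 ltr01 m2 (fun x _ => sqr_ge0 _).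
rewrite /sqnorm_integral -(cvg_lim _ c) //.
apply: (@le_lt_trans _ _ (a - 1)%:E); last exact: ltry.
apply: lime_le; first by apply/cvg_ex; eexists; exact: c.
apply: nearW => N; rewrite mulr1.
have -> : (a - 1)%:E = (\int[lam]_(x in I) (cst 1%:E) x)%E.
  by rewrite integral_cst //= lebesgue_measure_itv /= lte_fin a1 mul1e.
apply: ge0_le_integral => //.
- by move=> x _; rewrite lee_fin; apply: sumr_ge0 => k _; rewrite mulr_ge0 ?sqr_ge0 // exprz_ge0 // ltW.
- apply/measurable_EFinP.
  have m1 := measurable_energy a1 N mf.
  have m3 : measurable_fun I (fun x : mR => energy (dilates a inverse_transform x) N).
    by apply: (measurable_funS mRp _ m1); exact: fundamental_period_subset.
  by apply: eq_measurable_fun m3 => x _; rewrite energy_dilates.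
- move=> x Ix; rewrite lee_fin -(energy_dilates a1).
  rewrite (_ : energy _ N = energy (coef (indicator_fibre x)) N).
    apply: le_trans (sqnorm_indicator_fibre_le1 x).
    by apply: bessel; exact: indicator_fibre_square_integrable.
  by apply: eq_bigr => k _; rewrite dilates_inverse_transform.
Qed.

End FunctionsWithPrescribedTransform.

(** * Null sets and the completeness theorem *)

Section NullSets.
Context {R : realType}.
Local Notation lam := (@lebesgue_measure R).
Local Notation mR := (measurableTypeR R).

Lemma ae_forall_fin d (T : measurableType d) (mu : {measure set T -> \bar R})
    (L : nat) (P : 'I_L -> T -> Prop) :
  (forall l, {ae mu, forall x, P l x}) -> {ae mu, forall x, forall l, P l x}.
Proof.
move=> hP.
have : {ae mu, forall x, forall n : nat, forall nL : (n < L)%N, P (Ordinal nL) x}.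
  apply: ae_foralln => n; have [nL|Ln] := pselect (n < L)%N.
    apply: ae_mono (hP (Ordinal nL)) => x h nL'.
    by rewrite (bool_irrelevance nL' nL).
  by apply: aeW => x nL.
by apply: ae_mono => x h [n nL]; exact: h.
Qed.

(** Tonelli's theorem for null sets. *)
Lemma product_measure_eq0 (E : set (mR * mR)) : measurable E ->
  (lam \x lam)%E E = 0%E <-> {ae lam, forall x, lam (xsection E x) = 0%E}.
Proof.
move=> mE; have ms : measurable_fun setT (lam \o xsection E) by exact: measurable_fun_xsection.
have := ae_eq_integral_abs lam measurableT ms.
rewrite (_ : (\int[lam]_(x in setT) `|(lam \o xsection E) x|)%E = (lam \x lam)%E E).
  by move=> ->; split; apply: ae_mono => x h; [exact: h|move=> _; exact: h].
by apply: eq_integral => x _; rewrite gee0_abs.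
Qed.

Variables (a : R) (a1 : 1 < a).
Local Notation I := (`[1, a[%classic : set mR).

Let mI : measurable I. Proof. exact: measurable_itv. Qed.
Let mRp : measurable (Rplus R). Proof. exact: measurable_Rplus. Qed.

Lemma sqnorm_eq0 (D : set mR) (f : R -> R[i]) : measurable D ->
  cmeasurable D (f : mR -> R[i]) ->
  sqnorm_integral D f = 0%E <-> {ae lam, forall x, D x -> f x = 0}.
Proof.
move=> mD mf.
have mn : measurable_fun D (fun x : mR => (normc (f x) ^+ 2)%:E).
  by apply/measurable_EFinP; exact: measurable_normc_sq.
have := ae_eq_integral_abs lam mD mn.
rewrite (_ : (\int[lam]_(x in D) `|(normc (f x) ^+ 2)%:E|)%E = sqnorm_integral D f); last first.
  by apply: eq_integral => x _; rewrite gee0_abs // lee_fin sqr_ge0.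
move=> ->; split; apply: ae_mono => x h Dx; have := h Dx.
- by case=> /normc_sq_eq0.
- by move=> ->; rewrite ComplexField.Normc.normc0 expr0n.
Qed.

Lemma cvg_integral_energy (f : R -> R[i]) : L2 f ->
  (\int[lam]_(x in I) (energy (dilates a f x) N)%:E @[N --> \oo] -->
   sqnorm_integral (Rplus R) f)%E.
Proof.
move=> hf; have := ge0_integral_periodize a1 ltr01 (measurable_sq hf) (fun x _ => sqr_ge0 _).
rewrite mulr1; apply: cvg_trans; apply: near_eq_cvg; apply: nearW => N.
by apply: eq_integral => x _; rewrite energy_dilates.
Qed.

(** Both sides say that the squared norm of [f] is zero, once this norm is computed
    by periodization. *)
Lemma eqL2_0P (f : R -> R[i]) : L2 f ->
  eqL2 f (fun=> 0) <-> {ae lam, forall x, I x -> forall l, dilates a f x l = 0}.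
Proof.
move=> hf; have /(sqnorm_eq0 mRp) : cmeasurable (Rplus R) (f : mR -> R[i]) by exact: hf.1.
rewrite -/(eqL2 f (fun=> 0)) => <-; split=> [f0|d0].
  have e0 N : {ae lam, forall x, I x -> energy (dilates a f x) N = 0}.
    have me : measurable_fun I (fun x : mR => (energy (dilates a f x) N)%:E).
      apply/measurable_EFinP; have m1 := measurable_energy a1 N hf.1.
      by apply: (measurable_funS mRp _ m1); exact: fundamental_period_subset.
    have := ae_eq_integral_abs lam mI me.
    rewrite (_ : (\int[lam]_(x in I) `|(energy (dilates a f x) N)%:E|)%E = 0%E).
      by case=> /(_ erefl) h _; apply: ae_mono h => x h Ix; have := h Ix; case.
    apply/eqP; rewrite eq_le integral_ge0 ?andbT // -f0.
    have := integral_energy_le a1 N ltr01 hf; rewrite mulr1; apply: le_trans.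
    rewrite le_eqVlt; apply/orP; left; apply/eqP; apply: eq_integral => x _.
    by rewrite gee0_abs // lee_fin energy_ge0.
  apply: ae_mono (ae_foralln e0) => x h Ix l; apply: normc_sq_eq0.
  have e := h `|l|%N Ix.
  have kl : (absz (l + `|l|%N%:Z)%R < (2 * `|l|).+1)%N by lia.
  move/eqP: e; rewrite psumr_eq0 => [/allP /(_ (Ordinal kl))|k _]; last exact: sqr_ge0.
  rewrite mem_index_enum => /(_ isT) /= /eqP.
  by rewrite (_ : Posz (absz (l + `|l|%N%:Z)%R) - `|l|%N%:Z = l) //; lia.
have c := cvg_integral_energy hf.
rewrite -(cvg_lim _ c) // (_ : (fun N => _) = cst 0%E) ?lim_cst //.
apply/funext => N; transitivity (\int[lam]_(x in I) (cst 0%E) x)%E; last exact: integral0.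
apply: ge0_ae_eq_integral => //.
- apply/measurable_EFinP; have m1 := measurable_energy a1 N hf.1.
  by apply: (measurable_funS mRp _ m1); exact: fundamental_period_subset.
- by move=> x _; rewrite lee_fin energy_ge0.
- apply: ae_mono d0 => x h Ix /=; congr (_%:E); apply: big1 => k _.
  by rewrite h // ComplexField.Normc.normc0 expr0n.
Qed.

End NullSets.

Lemma sum_normr_sq_eq0 (R : realType) (L : nat) (z : 'I_L -> R[i]) :
  \sum_(l < L) `|z l| ^+ 2 = 0 <-> forall l, z l = 0.
Proof.
split=> [h l|z0]; last by apply: big1 => l _; rewrite z0 normr0 expr0n.
apply/eqP; rewrite -normr_eq0 -sqrf_eq0; apply/eqP.
by apply: (psumr_eq0P _ h) => // i _; rewrite exprn_ge0.
Qed.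

Theorem theorem2p1 (R : realType) (a : R) (L : nat) (psi : 'I_L -> R -> R[i])
    (ha : 1 < a)
    (hpsi : forall l, L2 (psi l))
    (hcard : forall i j : 'I_L, i <> j -> ~ eqL2 (psi i) (psi j)) :
  complete_system (MD psi a) <->
  {ae (@lebesgue_measure R \x @lebesgue_measure R)%E, forall z,
     `[1, a[%classic z.1 -> `[0, 1[%classic z.2 ->
     \sum_(l < L) `|Theta a (psi l) z| ^+ 2 != 0}.
Proof.
pose mR := measurableTypeR R.
pose lam := @lebesgue_measure R.
pose I : set mR := `[1, a[%classic; pose U : set mR := `[0, 1[%classic.
have mI : measurable I by exact: measurable_itv.
have mU : measurable U by exact: measurable_itv.
pose s z := \sum_(l < L) normc (Theta a (psi l) z) ^+ 2.
have ms : measurable_fun (Rplus R `*` setT) (s : mR * mR -> R).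
  apply: measurable_sum => l; apply: measurable_normc_sq.
  exact: cmeasurable_Theta.
(* The zero set of the sum, whose nullity is the condition of the theorem. *)
pose E : set (mR * mR) := (I `*` U) `&` [set z | forall l, Theta a (psi l) z = 0].
have mE : measurable E.
  have -> : E = (I `*` U) `&` ((Rplus R `*` setT) `&` s @^-1` [set 0]).
    apply/seteqP; split=> -[x xi] [[Ix Uxi]].
      move=> /= h; split=> //; split; first by split=> //; exact: (fundamental_period_subset (a := a)).
      by rewrite /s /= big1 // => l _; rewrite h ComplexField.Normc.normc0 expr0n.
    move=> /= [_ /eqP]; rewrite psumr_eq0 => [/allP h|l _]; last exact: sqr_ge0.
    split=> // l; apply: normc_sq_eq0; apply/eqP; exact: h.
  apply: measurableI; first exact: measurableX.
  by apply: ms => //; apply: measurableX => //; exact: measurable_Rplus.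
have -> : {ae (lam \x lam)%E, forall z, `[1, a[%classic z.1 -> `[0, 1[%classic z.2 ->
     \sum_(l < L) `|Theta a (psi l) z| ^+ 2 != 0} <-> (lam \x lam)%E E = 0%E.
  rewrite -(negligibleP _ mE) (_ : E = ~` [set z : mR * mR | `[1, a[%classic z.1 ->
      `[0, 1[%classic z.2 -> \sum_(l < L) `|Theta a (psi l) z| ^+ 2 != 0]) //.
  apply/seteqP; split=> z /=.
    move=> [[Iz Uz] h] nz; have /eqP := nz Iz Uz; apply.
    exact/sum_normr_sq_eq0.
  move=> /not_implyP[Iz /not_implyP[Uz /negP]]; rewrite negbK => /eqP h.
  by split=> // l; have /sum_normr_sq_eq0 := h; apply.
rewrite product_measure_eq0 //.
split=> [compl|E0 f hf orth].
  (* The transform of [f] is the indicator of [E], where all the transforms of the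
     generators vanish: [f] is orthogonal to the system. *)
  pose f := inverse_transform a E.
  have hf : L2 f by exact: L2_inverse_transform.
  have ThetaE : {ae lam, forall x, I x -> {ae lam, forall xi, U xi ->
      Theta a f (x, xi) = indicator_fibre E x xi}}.
    apply: ae_mono (Theta_fourier_series ha hf) => x h Ix.
    have hx := h (fundamental_period_subset Ix).
    have F2 := fourier_series_square_integrable hx.
    have e2 := indicator_fibre_square_integrable mE x.
    have d2 := square_integrableB mU F2 e2.
    have : {ae lam, forall xi, U xi -> Theta a f (x, xi) - indicator_fibre E x xi = 0}.
      apply: coef_eq0; first exact: cintegrable_square_integrable.
      move=> l; rewrite coef_sub // (coef_fourier_series l hx).
      by rewrite dilates_inverse_transform // subrr.
    by apply: ae_mono => xi h0 Uxi; apply/eqP; rewrite -subr_eq0 h0.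
  have f0 : eqL2 f (fun=> 0).
    apply: compl => // g [m [j [l ->]]].
    apply: ((orthogonal_atomsP ha hf (hpsi l)).2 _ m j).
    apply: ae_mono ThetaE => x h Ix; apply: ae_mono (h Ix) => xi h' Uxi.
    rewrite /Theta_product h' // /indicator_fibre indicE.
    have [xE|_] := boolP ((x, xi) \in E); last by rewrite mul0r.
    by move: xE; rewrite inE => -[_ ->]; rewrite conjc0 mulr0.
  apply: ae_mono ((eqL2_0P ha hf).1 f0) => x h.
  have [Ix|nIx] := pselect (I x); last first.
    rewrite (_ : xsection E x = set0) ?measure0 //.
    by apply/seteqP; split=> // xi /xsectionP[[]].
  apply/negligibleP; first exact: measurable_xsection.
  have e2 := indicator_fibre_square_integrable mE x.
  have := coef_eq0 (cintegrable_square_integrable e2)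
    (fun l => etrans (esym (dilates_inverse_transform ha E l Ix)) (h Ix l)).
  apply: negligibleS => xi /xsectionP xE /= h0.
  have Uxi : U xi by case: xE => -[].
  move: (h0 Uxi); rewrite /indicator_fibre indicE mem_set // => -[].
  by apply/eqP; exact: oner_neq0.
(* The transform of [f] vanishes wherever one of those of the generators does
   not, hence almost everywhere. *)
have prod0 : {ae lam, forall x, forall l, I x ->
    {ae lam, forall xi, U xi -> Theta_product a f (psi l) x xi = 0}}.
  apply: ae_forall_fin => l; apply: (orthogonal_atomsP ha hf (hpsi l)).1 => m j.
  by apply: orth; exists m, j, l.
apply/(eqL2_0P ha hf).
apply: ae_mono (ae_and (ae_and prod0 E0) (Theta_fourier_series ha hf)).
move=> x [[p0 e0] hx] Ix l; have {}hx := hx (fundamental_period_subset Ix).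
rewrite -(coef_fourier_series l hx); apply: ae_eq0_cintegral => //.
  exact: (cmeasurableM hx.1 (cmeasurableJ (char_square_integrable l).1)).
have nE : {ae lam, forall xi, ~ E (x, xi)}.
  have /negligibleP : lam (xsection E x) = 0%E by [].
  move=> /(_ (measurable_xsection _ mE)); apply: negligibleS => xi /= nn.
  by apply/xsectionP; apply: contrapT.
have p0' : {ae lam, forall xi, forall l, U xi -> Theta_product a f (psi l) x xi = 0}.
  by apply: ae_forall_fin => l'; exact: p0.
apply: ae_mono (ae_and nE p0') => xi [nExi hp] Uxi.
have [l' hl'] : exists l', Theta a (psi l') (x, xi) <> 0.
  by apply/not_existsP => all0; apply: nExi; split=> // l'; apply: contrapT; exact: all0.
have /eqP := hp l' Uxi; rewrite /Theta_product mulf_eq0 conjc_eq0.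
by case/orP => /eqP; [move=> ->; rewrite mul0r|move/hl'].
Qed.
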